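(* Let $\epsilon,\delta,\alpha\in(0,1)$. Consider the following dynamic trace estimation problem: $A_1,\dots,A_m$ are real $n\times n$ matrices satisfying $\|A_i\|_*\le 1$ for all $i\in\{1,\dots,m\}$ and $\|A_{i+1}-A_i\|_*\le\alpha$ for all $i\in\{1,\dots,m-1\}$; they can be accessed only through matrix-vector products, in sequence; the goal is to output numbers $t_1,\dots,t_m$ such that for every $i$, $\Pr[|t_i-\mathrm{tr}(A_i)|\ge\epsilon]\le\delta$. Then the DeltaShift++ algorithm (described in the context), run with $\ell_0=O(\sqrt{1/\delta}/\epsilon)$, $\ell=O(\sqrt{\alpha/\delta}/\epsilon)$ (for suitable absolute constants) and $\gamma=\alpha$, solves this problem, using in total $$O\!\left(m\cdot\frac{\sqrt{\alpha/\delta}}{\epsilon}+\frac{\sqrt{1/\delta}}{\epsilon}\right)$$ matrix-vector multiplications with $A_1,\dots,A_m$.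
   Context: $\|B\|_*=\sum_k\sigma_k(B)$ denotes the nuclear norm (sum of singular values). For a square matrix $B\in\mathbb{R}^{n\times n}$ and a positive integer $\ell$ divisible by $3$, the Hutch++ estimator $h^{++}_\ell(B)$ (of Meyer, Musco, Musco, Woodruff) is computed with $\ell$ matrix-vector products with $B$ as follows: draw independent Rademacher ($\pm1$ i.i.d. entries) matrices $S,G\in\mathbb{R}^{n\times \ell/3}$; let $Q$ be a matrix whose columns form an orthonormal basis of the column span of $BS$; output $$h^{++}_\ell(B)=\mathrm{tr}(Q^TBQ)+\frac{3}{\ell}\mathrm{tr}\big(G^T(I-QQ^T)B(I-QQ^T)G\big).$$ When $B=A_j-A_{j-1}$, matrix-vector products with $B$ are computed via products with $A_j$ and $A_{j-1}$. The DeltaShift++ algorithm with inputs positive integers $\ell_0,\ell$ and damping factor $\gamma\in[0,1]$ sets $t_1=h^{++}_{\ell_0}(A_1)$ and, for $j=2,\dots,m$, $$t_j=\gamma\,h^{++}_\ell(A_j)+(1-\gamma)\big(t_{j-1}+h^{++}_\ell(A_j-A_{j-1})\big),$$ where every invocation of $h^{++}$ uses fresh independent randomness.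
   Formalization: Since ℓ must be a positive multiple of 3, ℓ is rounded up to 3⌈c·x⌉ with x=√(α/δ)/ε, and the total is bounded by O(m·max(1,x)+√(1/δ)/ε); the literal O(m·x+√(1/δ)/ε) fails when x is small (e.g. α=1/m²). *)

(* Defs.v *)
From HB Require Import structures.
From mathcomp Require Import all_boot all_order all_algebra.
From mathcomp Require Import polyrcf.
From mathcomp Require Import boolp reals.

Set Implicit Arguments.
Unset Strict Implicit.
Unset Printing Implicit Defensive.

Import Order.TTheory GRing.Theory Num.Theory.
Local Open Scope ring_scope.

(* Square roots of the roots of the characteristic polynomial of B^T B, each
   repeated with its multiplicity. *)
Definition singular_values (R : realType) (n : nat) (B : 'M[R]_n) : seq R :=
  let p := char_poly (B^T *m B) in
  flatten [seq nseq (mup x p) (Num.sqrt x) | x <- rootsR p].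

Definition nuclear_norm (R : realType) (n : nat) (B : 'M[R]_n) : R :=
  \sum_(s <- singular_values B) s.

(* Randomized algorithms whose only access to a sequence A_1, A_2, ... of n x n
   matrices is the evaluation of products A_i v: [MatVec i v k] continues as
   k (A_i v), and [Rademacher q k] continues as k S for a fresh n x q matrix S
   of independent uniform signs. *)
Inductive alg (R : realType) (n : nat) (X : Type) : Type :=
| Ret of X
| Rademacher (q : nat) of ('M[R]_(n, q) -> alg R n X)
| MatVec (i : nat) (v : 'cV[R]_n) of ('cV[R]_n -> alg R n X).

Arguments Ret {R n X} _.
Arguments Rademacher {R n X} q _.
Arguments MatVec {R n X} i v _.

Fixpoint bind (R : realType) (n : nat) (X Y : Type) (p : alg R n X)
    (f : X -> alg R n Y) {struct p} : alg R n Y :=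
  match p with
  | Ret x => f x
  | Rademacher q k => Rademacher q (fun S => bind (k S) f)
  | MatVec i v k => MatVec i v (fun w => bind (k w) f)
  end.

Notation "'let*' x ':=' p 'in' q" := (bind p (fun x => q))
  (at level 200, x name, p at level 100, q at level 200).

Definition sign_mx (R : realType) (n q : nat) (S : 'M[bool]_(n, q)) :
  'M[R]_(n, q) := map_mx (fun b : bool => (-1) ^+ b) S.

(* Probability that the output satisfies E: every Rademacher matrix is uniform
   over all sign matrices, independently of what happened before. *)
Fixpoint Pr (R : realType) (n : nat) (X : Type) (A : nat -> 'M[R]_n)
    (p : alg R n X) (E : X -> bool) {struct p} : R :=
  match p with
  | Ret x => (E x)%:R
  | Rademacher q k =>
      (\sum_(S : 'M[bool]_(n, q)) Pr A (k (sign_mx R S)) E)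
        / #|{: 'M[bool]_(n, q)}|%:R
  | MatVec i v k => Pr A (k (A i *m v)) E
  end.

(* Number of matrix-vector products, in the worst case over the signs. *)
Fixpoint num_matvec (R : realType) (n : nat) (X : Type) (A : nat -> 'M[R]_n)
    (p : alg R n X) {struct p} : nat :=
  match p with
  | Ret _ => 0%N
  | Rademacher q k => (\max_(S : 'M[bool]_(n, q)) num_matvec A (k (sign_mx R S)))%N
  | MatVec i v k => (num_matvec A (k (A i *m v))).+1
  end.

(* A way of computing products B v, for some n x n matrix B. *)
Definition oracle (R : realType) (n : nat) := 'cV[R]_n -> alg R n 'cV[R]_n.

Definition orc (R : realType) (n : nat) (i : nat) : oracle R n :=
  fun v => MatVec i v (fun w => Ret w).

Definition orc_diff (R : realType) (n : nat) (i j : nat) : oracle R n :=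
  fun v => let* x := orc i v in let* y := orc j v in Ret (x - y).

(* B V, column by column. *)
Fixpoint matmul (R : realType) (n : nat) (B : oracle R n) (q : nat) :
    'M[R]_(n, q) -> alg R n 'M[R]_(n, q) :=
  match q return 'M[R]_(n, q) -> alg R n 'M[R]_(n, q) with
  | 0 => fun V => Ret V
  | q'.+1 => fun V : 'M[R]_(n, 1 + q') =>
      let* y := B (lsubmx V) in
      let* Y := matmul B (rsubmx V) in
      Ret (row_mx y Y : 'M[R]_(n, 1 + q'))
  end.

(* The columns of Q form an orthonormal basis of the column span of Y; they are
   then \rank Y in number. *)
Definition orthonormal_basis (R : realType) (n q : nat) (Y : 'M[R]_(n, q))
    (Q : 'M[R]_(n, \rank Y)) : Prop :=
  Q^T *m Q = 1%:M /\ (Q^T :=: Y^T)%MS.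

(* A subroutine choosing the matrix Q from Y = BS; see [orthonormalizes]. *)
Definition orthonormalizer (R : realType) (n : nat) :=
  forall (q : nat) (Y : 'M[R]_(n, q)), 'M[R]_(n, \rank Y).

Definition orthonormalizes (R : realType) (n : nat)
    (orth : orthonormalizer R n) : Prop :=
  forall (q : nat) (Y : 'M[R]_(n, q)), orthonormal_basis (orth q Y).

Definition hutchpp (R : realType) (n : nat) (orth : orthonormalizer R n)
    (l : nat) (B : oracle R n) : alg R n R :=
  Rademacher (l %/ 3) (fun S =>
  Rademacher (l %/ 3) (fun G =>
  let* Y := matmul B S in
  let Q := orth _ Y in
  let* Z := matmul B Q in
  let* W := matmul B ((1%:M - Q *m Q^T) *m G) in
  Ret (\tr (Q^T *m Z) + 3 / l%:R * \tr (G^T *m (1%:M - Q *m Q^T) *m W)))).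

(* Outputs the sequence [:: t_1; ...; t_m]. *)
Fixpoint deltashiftpp (R : realType) (n : nat) (orth : orthonormalizer R n)
    (l0 l : nat) (gamma : R) (m : nat) {struct m} : alg R n (seq R) :=
  match m with
  | 0 => Ret [::]
  | 1 => let* t := hutchpp orth l0 (orc 1) in Ret [:: t]
  | j.+1 =>
      let* ts := deltashiftpp orth l0 l gamma j in
      let* a := hutchpp orth l (orc j.+1) in
      let* b := hutchpp orth l (orc_diff j.+1 j) in
      Ret (rcons ts (gamma * a + (1 - gamma) * (last 0 ts + b)))
  end.

(* A multiple of 3 of order z, rounded up; positive when 0 < z. *)
Definition sample_size (R : realType) (z : R) : nat :=
  (3 * `|Num.ceil z|)%N.

(* The closed formula for the estimator; by [hutchppP] below, [hutchpp] outputs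
   it for two independent Rademacher matrices. *)
Definition hutchpp_value (R : realType) (n : nat) (orth : orthonormalizer R n)
    (l : nat) (B : 'M[R]_n) (S G : 'M[R]_(n, l %/ 3)) : R :=
  let Q := orth _ (B *m S) in
  \tr (Q^T *m B *m Q)
  + 3 / l%:R * \tr (G^T *m (1%:M - Q *m Q^T) *m B *m (1%:M - Q *m Q^T) *m G).

(* o evaluates v |-> B v with d products with the A_i. *)
Definition computes (R : realType) (n : nat) (A : nat -> 'M[R]_n)
    (o : oracle R n) (B : 'M[R]_n) (d : nat) : Prop :=
  forall v (X : Type) (f : 'cV[R]_n -> alg R n X),
    (forall E, Pr A (bind (o v) f) E = Pr A (f (B *m v)) E) /\
    num_matvec A (bind (o v) f) = (d + num_matvec A (f (B *m v)))%N.

Lemma computes_orc (R : realType) (n : nat) (A : nat -> 'M[R]_n) i :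
  computes A (@orc R n i) (A i) 1.
Proof. by []. Qed.

Lemma computes_orc_diff (R : realType) (n : nat) (A : nat -> 'M[R]_n) i j :
  computes A (@orc_diff R n i j) (A i - A j) 2.
Proof. by move=> v X f; rewrite /= mulmxBl. Qed.

Lemma bindA (R : realType) (n : nat) (A : nat -> 'M[R]_n) (X Y Z : Type)
    (p : alg R n X) (f : X -> alg R n Y) (g : Y -> alg R n Z) :
  (forall E, Pr A (bind (bind p f) g) E = Pr A (bind p (fun x => bind (f x) g)) E)
  /\ num_matvec A (bind (bind p f) g)
     = num_matvec A (bind p (fun x => bind (f x) g)).
Proof.
elim: p => [x|q k IH|i v k IH] //=; last by have [IH1 ->] := IH (A i *m v); split.
split=> [E|]; last by apply: eq_bigr => S _; case: (IH (sign_mx R S)).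
by congr (_ / _); apply: eq_bigr => S _; case: (IH (sign_mx R S)).
Qed.

Lemma matmulP (R : realType) (n : nat) (A : nat -> 'M[R]_n) (o : oracle R n)
    (B : 'M[R]_n) (d : nat) : computes A o B d ->
  forall q (V : 'M[R]_(n, q)) (X : Type) (f : 'M[R]_(n, q) -> alg R n X),
    (forall E, Pr A (bind (matmul o V) f) E = Pr A (f (B *m V)) E) /\
    num_matvec A (bind (matmul o V) f) = (q * d + num_matvec A (f (B *m V)))%N.
Proof.
move=> oB; elim=> [|q IHq] V X f.
  by have -> : B *m V = V by apply/matrixP => i [].
pose h (y : 'cV[R]_n) (Y : 'M[R]_(n, q)) :=
  Ret (row_mx y Y : 'M[R]_(n, 1 + q)) : alg R n _.
pose g (y : 'cV[R]_n) := bind (matmul o (@rsubmx R n 1 q V)) (h y).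
rewrite [matmul o V]/(bind (o (@lsubmx R n 1 q V)) g).
have [P1 ->] := bindA A (o (@lsubmx R n 1 q V)) g f.
have [P2 ->] := oB (@lsubmx R n 1 q V) _ (fun y => bind (g y) f).
set y := B *m @lsubmx R n 1 q V in P2 *.
have [P3 ->] := bindA A (matmul o (@rsubmx R n 1 q V)) (h y) f.
have [P4 ->] := IHq (@rsubmx R n 1 q V) _ (fun Y => bind (h y Y) f).
have BV : row_mx (B *m @lsubmx R n 1 q V) (B *m @rsubmx R n 1 q V) = B *m V.
  by rewrite -mul_mx_row hsubmxK.
split=> [E|]; last by rewrite /= BV mulSn addnA.
by rewrite P1 P2 P3 P4 /= BV.
Qed.

Lemma hutchppP (R : realType) (n : nat) (A : nat -> 'M[R]_n) (o : oracle R n)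
    (B : 'M[R]_n) (d : nat) (orth : orthonormalizer R n) (l : nat) :
  computes A o B d ->
  (forall E, Pr A (hutchpp orth l o) E =
     (\sum_(S : 'M[bool]_(n, l %/ 3))
        (\sum_(G : 'M[bool]_(n, l %/ 3))
           (E (hutchpp_value orth B (sign_mx R S) (sign_mx R G)))%:R)
        / #|{: 'M[bool]_(n, l %/ 3)}|%:R) / #|{: 'M[bool]_(n, l %/ 3)}|%:R) /\
  (num_matvec A (hutchpp orth l o) <= l * d)%N.
Proof.
move=> oB; rewrite /hutchpp /=; split=> [E|].
  congr (_ / _); apply: eq_bigr => S _; congr (_ / _); apply: eq_bigr => G _.
  by rewrite !(matmulP oB _ _).1 /= !mulmxA.
apply/bigmax_leqP => S _; apply/bigmax_leqP => G _.
rewrite !(matmulP oB _ _).2 /= addn0 -!mulnDl leq_mul2r; apply/orP; right.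
rewrite addnA (leq_trans _ (leq_divM l 3)) // mulnC !mulSn mul0n addn0.
by rewrite addnA leq_add2r leq_add2l rank_leq_col.
Qed.

Lemma orthonormalizer_exists (R : realType) (n : nat) :
  exists orth : orthonormalizer R n, orthonormalizes orth.
Proof.
have gram_schmidt p (M : 'M[R]_(p, n)) : exists r (P : 'M[R]_(r, n)),
    P *m P^T = 1%:M /\ (P :=: M)%MS.
  elim: p M => [|p IHp] M.
    by exists 0%N, 0; split; [apply/matrixP => - []|rewrite (flatmx0 M)].
  rewrite -[M](@vsubmxK _ 1 p); move: (@usubmx _ 1 p _ _) (@dsubmx _ 1 p _ _).
  move=> u {}M; have [r [P [PP PM]]] := IHp M.
  suff [r' [P' [PP' PM']]] : exists r (P : 'M[R]_(r, n)),
      P *m P^T = 1%:M /\ (P :=: u + M)%MS.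
    by exists r', P'; split=> //; apply: eqmx_trans PM' (addsmxE _ _).
  pose w := u - u *m P^T *m P.
  have wP : w *m P^T = 0 by rewrite mulmxBl -[X in _ - X]mulmxA PP mulmx1 subrr.
  have uwP : (u + M :=: w + P)%MS.
    apply: eqmx_trans (adds_eqmx (eqmx_refl u) (eqmx_sym PM)) _.
    apply/eqmxP/andP; split; rewrite addsmx_sub addsmxSr andbT.
      have -> : u = w + u *m P^T *m P by rewrite subrK.
      by rewrite addmx_sub_adds ?submxMl.
    by rewrite addmx_sub ?addsmxSl // -mulNmx (submx_trans (submxMl _ _)) ?addsmxSr.
  have [w0|wN0] := eqVneq w 0.
    exists r, P; split=> //; apply/eqmx_sym/(eqmx_trans uwP).
    by rewrite w0; exact: adds0mx.
  pose s := \sum_j (w 0 j) ^+ 2.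
  have ww : w *m w^T = s%:M.
    apply/matrixP => i j; rewrite !ord1 !mxE eqxx mulr1n.
    by apply: eq_bigr => k _; rewrite [w^T _ _]mxE expr2.
  have s_gt0 : 0 < s.
    rewrite lt_def sumr_ge0 ?andbT => [|j _]; last exact: sqr_ge0.
    apply: contraNneq wN0 => /eqP; rewrite psumr_eq0 => [/allP w0|j _];
      last exact: sqr_ge0.
    apply/eqP/rowP => j; have := w0 j (mem_index_enum _).
    by rewrite [RHS]mxE /= sqrf_eq0 => /eqP.
  pose a := (Num.sqrt s)^-1.
  have a2 : a * a * s = 1.
    by rewrite -expr2 exprVn sqr_sqrtr ?ltW // mulVf // gt_eqF.
  exists (1 + r)%N, (col_mx (a *: w) P); split; last first.
    apply: eqmx_trans (eqmx_sym (addsmxE _ _)) _.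
    apply: eqmx_trans _ (eqmx_sym uwP).
    by apply: adds_eqmx (eqmx_refl P); apply: eqmx_scale; rewrite invr_eq0 gt_eqF ?sqrtr_gt0.
  rewrite tr_col_mx mul_col_row PP -!scalemxAl wP scaler0.
  rewrite !linearZ /= ww scalerA scale_scalar_mx a2.
  have -> : P *m w^T = 0 by rewrite -[P]trmxK -trmx_mul wP trmx0.
  by rewrite scaler0 -scalar_mx_block.
have basis q (Y : 'M[R]_(n, q)) :
    exists Q : 'M[R]_(n, \rank Y), orthonormal_basis Q.
  have [r [P [PP PY]]] := gram_schmidt q Y^T.
  have rE : r = \rank Y.
    rewrite -mxrank_tr -PY; apply/eqP; rewrite eqn_leq rank_leq_row andbT.
    by rewrite -[X in (X <= _)%N](@mxrank1 R) -PP mxrankM_maxl.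
  move: P PP PY; rewrite rE => P PP PY.
  by exists P^T; rewrite /orthonormal_basis trmxK.
by exists (fun q Y => projT1 (cid (basis q Y))) => q Y; case: cid.
Qed.

(* Main.v *)
Require Import Defs.
From mathcomp Require Import all_boot all_order all_algebra.
From mathcomp Require Import ring lra polyrcf complex.
From mathcomp Require Import reals.

(** Idea. The error of Hutch++ is, conditionally on the sketch [S], that of Hutchinson's
    estimator on the deflated matrix, so its mean square is at most [2 / q] times the
    expected squared Frobenius error of the sketch ([q = l / 3] columns).  That error is
    bounded by adding the columns of [S] one at a time: if [C] is the current residual
    and [M = C^T C], a new sign vector [s] removes [s^T M^2 s / s^T M s] from
    [f = \tr M], and by the fourth moments of [s] this is at least [\tr M^2 / (3 \tr M)] on
    average.  Interpolation between Schatten norms gives [\tr M^2 >= f^3 / N^2], where [N]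
    is the nuclear norm, hence [E f' <= f - f^2 / (3 N^2)] and [E f <= 3 N^2 / q] after [q]
    columns.  The mean square error of Hutch++ is thus at most [6 N^2 / q^2], and in
    DeltaShift++ the damping makes these errors sum geometrically; Chebyshev's
    inequality concludes. *)

Set Implicit Arguments.
Unset Strict Implicit.
Unset Printing Implicit Defensive.

Import Order.TTheory GRing.Theory Num.Theory.
Local Open Scope ring_scope.

(** * Singular values *)

Lemma mulmx_tr_rowE (R : comNzRingType) (n : nat) (u v : 'rV[R]_n) :
  u *m v^T = (\sum_j u 0 j * v 0 j)%:M.
Proof.
apply/matrixP => i j; rewrite !ord1 !mxE eqxx mulr1n.
by apply: eq_bigr => k _; rewrite mxE.
Qed.

Lemma sum_sqr_row_eq0 (R : realDomainType) (n : nat) (u : 'rV[R]_n) :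
  (\sum_j u 0 j * u 0 j == 0) = (u == 0).
Proof.
apply/idP/eqP => [|->]; last by rewrite big1 // => j _; rewrite mxE mul0r.
rewrite psumr_eq0 => [/allP u0|j _]; last by rewrite -expr2 sqr_ge0.
apply/rowP => j; rewrite mxE; apply/eqP; have := u0 j (mem_index_enum _).
by rewrite /= mulf_eq0 orbb.
Qed.

(** Over the algebraically closed [R[i]] there is an eigenvector [p + i q]. Comparing
    [p *m A *m q^T] with its transpose forces the imaginary part of the eigenvalue to vanish; then
    whichever of [p] and [q] is nonzero is a real eigenvector. *)
Lemma symmetric_real_eigenvector (R : rcfType) (n : nat) (A : 'M[R]_n.+1) :
  A^T = A -> exists a (u : 'rV[R]_n.+1), u != 0 /\ u *m A = a *: u.
Proof.
move=> Asym; pose AC : 'M[R[i]]_n.+1 := map_mx (real_complex R) A.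
have [z /eigenvalueP[v vA v0]] := eigenvalue_closed AC isT.
pose p : 'rV[R]_n.+1 := \row_j complex.Re (v 0 j).
pose q : 'rV[R]_n.+1 := \row_j complex.Im (v 0 j).
have vAj j : \sum_k v 0 k * (A k j)%:C%C = z * v 0 j.
  by have /rowP/(_ j) := vA; rewrite !mxE => <-; apply: eq_bigr => k _; rewrite mxE.
case: z vA vAj => x y vA vAj.
have ReS (I : finType) (F : I -> R[i]) : complex.Re (\sum_i F i) = \sum_i complex.Re (F i).
  exact: (big_morph (@complex.Re R) (fun a b => raddfD (@complex.Re R : Rcomplex R -> R) a b) erefl).
have ImS (I : finType) (F : I -> R[i]) : complex.Im (\sum_i F i) = \sum_i complex.Im (F i).
  exact: (big_morph (@complex.Im R) (fun a b => raddfD (@complex.Im R : Rcomplex R -> R) a b) erefl).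
have pA : p *m A = x *: p - y *: q.
  apply/rowP => j; have := congr1 (@complex.Re R) (vAj j); rewrite ReS !mxE.
  case: (v 0 j) => a b /= <-; apply: eq_bigr => k _; rewrite mxE.
  by case: (v 0 k) => c d /=; rewrite mulr0 subr0.
have qA : q *m A = x *: q + y *: p.
  apply/rowP => j; have := congr1 (@complex.Im R) (vAj j); rewrite ImS !mxE.
  case: (v 0 j) => a b /= <-; apply: eq_bigr => k _; rewrite mxE.
  by case: (v 0 k) => c d /=; rewrite mulr0 add0r.
have y0 : y = 0.
  have /matrixP/(_ 0 0) : p *m A *m q^T = (q *m A *m p^T)^T.
    by rewrite !trmx_mul trmxK Asym mulmxA.
  have qp : \sum_j q 0 j * p 0 j = \sum_j p 0 j * q 0 j.
    by apply: eq_bigr => j _; rewrite mulrC.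
  rewrite [RHS]mxE pA qA mulmxBl mulmxDl -!scalemxAl !mulmx_tr_rowE qp => h.
  have /eqP : y * (\sum_j p 0 j * p 0 j + \sum_j q 0 j * q 0 j) = 0.
    move: (\sum_j p 0 j * q 0 j) (\sum_j p 0 j * p 0 j) (\sum_j q 0 j * q 0 j) h.
    by move=> a b c; rewrite !mxE eqxx !mulr1n; lra.
  rewrite mulf_eq0 => /orP[/eqP //|]; rewrite paddr_eq0; last 2 first.
  - by apply: sumr_ge0 => j _; rewrite -expr2 sqr_ge0.
  - by apply: sumr_ge0 => j _; rewrite -expr2 sqr_ge0.
  rewrite !sum_sqr_row_eq0 => /andP[/eqP p0 /eqP q0]; case/eqP: v0.
  apply/rowP => j; move/rowP/(_ j): p0; move/rowP/(_ j): q0; rewrite !mxE.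
  by case: (v 0 j) => a b /= -> ->.
have [p0|p0] := eqVneq p 0; last first.
  by exists x, p; split=> //; rewrite pA y0 scale0r subr0.
exists x, q; split; last by rewrite qA y0 scale0r addr0.
apply: contraNneq v0 => q0; apply/eqP/rowP => j.
move/rowP/(_ j): p0; move/rowP/(_ j): q0; rewrite !mxE.
by case: (v 0 j) => a b /= -> ->.
Qed.

(* A Householder reflection. *)
Lemma orthogonal_with_first_row (R : realFieldType) (n : nat)
    (u : 'rV[R]_(1 + n)) : u *m u^T = 1%:M ->
  exists H : 'M[R]_(1 + n), H *m H^T = 1%:M /\ delta_mx 0 0 *m H = u.
Proof.
move=> uu; pose e : 'rV[R]_(1 + n) := delta_mx 0 0.
have ee : e *m e^T = 1%:M.
  by rewrite trmx_delta mul_delta_mx; apply/matrixP => i j; rewrite !ord1 !mxE.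
have [w wE] : exists w, w = u - e by exists (u - e).
pose s := \sum_j w 0 j * w 0 j.
have ww : w *m w^T = s%:M by rewrite mulmx_tr_rowE.
have [w0|w0] := eqVneq w 0.
  exists 1%:M; rewrite trmx1 !mulmx1; split=> //.
  by apply/esym/eqP; rewrite -subr_eq0 -/e -wE w0.
have s0 : s != 0 by rewrite sum_sqr_row_eq0.
exists (1%:M - (2 / s) *: (w^T *m w)); split.
  set K := w^T *m w.
  have KK : K *m K = s *: K.
    by rewrite /K mulmxA -(mulmxA w^T) ww mul_mx_scalar scalemxAl.
  have -> : (1%:M - (2 / s) *: K)^T = 1%:M - (2 / s) *: K.
    have KT : K^T = K by rewrite trmx_mul trmxK.
    by rewrite -{2}KT; apply/matrixP => i j; clearbody K; rewrite !mxE eq_sym.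
  rewrite mulmxBl mul1mx mulmxBr mulmx1 -scalemxAl -scalemxAr scalerA KK scalerA.
  rewrite opprB -addrA -[RHS]addr0; congr (_ + _); rewrite -!scaleNr -!scalerDl.
  suff -> : - (2 / s) + (2 / s * (2 / s) * s + - (2 / s)) = 0 by rewrite scale0r.
  by field.
pose a := \sum_j e 0 j * w 0 j.
have ew : e *m w^T = a%:M by rewrite mulmx_tr_rowE.
(* Both [u] and [e] are unit vectors; this is why the reflection sends [e] to [u]. *)
have sa : s = - 2 * a.
  have uE : u = e + w by rewrite wE addrC subrK.
  move: uu; rewrite uE [(e + w)^T]linearD /= mulmxDr !mulmxDl ee ew ww.
  have -> : w *m e^T = a%:M by rewrite -[w *m _]trmxK trmx_mul trmxK ew tr_scalar_mx.
  by move/matrixP/(_ 0 0); rewrite !mxE eqxx !mulr1n; lra.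
rewrite mulmxBr mulmx1 -scalemxAr mulmxA ew mul_scalar_mx scalerA.
have -> : 2 / s * a = -1.
  have a0 : a != 0 by apply: contraNneq s0 => a0; rewrite sa a0 mulr0.
  by rewrite sa; field.
by rewrite scaleN1r opprK wE addrC subrK.
Qed.

(** Induction on the dimension: an orthogonal change of basis carries a unit eigenvector to the
    first basis vector, symmetry clears the rest of the first row and column, and the induction
    hypothesis diagonalizes the remaining block. *)
Lemma spectral_theorem_real (R : rcfType) (n : nat) (A : 'M[R]_n) : A^T = A ->
  exists (W : 'M[R]_n) (d : 'rV[R]_n),
    W *m W^T = 1%:M /\ W *m A *m W^T = diag_mx d.
Proof.
elim: n A => [|n IHn] A Asym.
  by exists 1%:M, 0; split; apply/matrixP => - [].
have [a [u [u0 uA]]] := symmetric_real_eigenvector Asym.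
pose s := \sum_j u 0 j * u 0 j.
have s_gt0 : 0 < s.
  rewrite lt_def sum_sqr_row_eq0 u0 sumr_ge0 // => j _.
  by rewrite -expr2 sqr_ge0.
pose v := (Num.sqrt s)^-1 *: u.
have vv : v *m v^T = 1%:M.
  rewrite linearZ /= -scalemxAl -scalemxAr scalerA mulmx_tr_rowE -/s -expr2 exprVn.
  by rewrite sqr_sqrtr ?ltW // scale_scalar_mx mulVf // gt_eqF.
have vA : v *m A = a *: v by rewrite -scalemxAl uA !scalerA mulrC.
have [H [HH eH]] := orthogonal_with_first_row vv.
have [B BE] : exists B : 'M[R]_(1 + n), B = H *m A *m H^T by eexists.
have Bsym : B^T = B by rewrite BE !trmx_mul trmxK Asym mulmxA.
have eB : delta_mx 0 0 *m B = a *: delta_mx 0 0 :> 'rV_(1 + n).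
  by rewrite BE !mulmxA eH vA -scalemxAl -eH -mulmxA HH mulmx1.
have B0 j : B 0 j = a *+ (j == 0).
  by move/rowP/(_ j): eB; rewrite -rowE !mxE eqxx /= mulr_natr.
have Bblock : B = block_mx a%:M 0 0 (drsubmx B).
  rewrite -[LHS]submxK; congr block_mx; apply/matrixP => i j.
  - by rewrite !ord1 !mxE !lshift0 B0.
  - by rewrite !ord1 !mxE lshift0 B0.
  - by rewrite -Bsym !ord1 !mxE lshift0 B0.
have [W [d [WW WB]]] := IHn (drsubmx B) (etrans (trmx_drsub B) (congr1 drsubmx Bsym)).
pose U : 'M[R]_(1 + n) := block_mx 1%:M 0 0 W.
have UU : U *m U^T = 1%:M.
  rewrite /U tr_block_mx mulmx_block !trmx0 trmx1 !mulmx0 !mul0mx mulmx1.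
  by rewrite !addr0 add0r WW -scalar_mx_block.
have UBU : U *m B *m U^T = diag_mx (row_mx a%:M d).
  rewrite Bblock /U tr_block_mx !mulmx_block.
  rewrite !trmx0 trmx1 !(mulmx0, mul0mx, mulmx1, mul1mx, addr0, add0r) WB.
  rewrite diag_mx_row; congr block_mx; apply/matrixP => i j.
  by rewrite !ord1 !mxE.
exists (U *m H), (row_mx a%:M d); split.
  by rewrite trmx_mul mulmxA -(mulmxA U) HH mulmx1.
by rewrite -UBU BE trmx_mul !mulmxA.
Qed.

Lemma char_poly_conj (R : comNzRingType) (n : nat) (A W V : 'M[R]_n) :
  W *m V = 1%:M -> char_poly (W *m A *m V) = char_poly A.
Proof.
move=> WV; have WVP : map_mx polyC W *m map_mx polyC V = 1%:M.
  by rewrite -map_mxM WV map_mx1.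
rewrite /char_poly.
have -> : char_poly_mx (W *m A *m V)
    = map_mx polyC W *m char_poly_mx A *m map_mx polyC V.
  rewrite /char_poly_mx mulmxBr mulmxBl mul_mx_scalar -scalemxAl WVP scalemx1.
  by rewrite !map_mxM.
rewrite !det_mulmx mulrAC -det_mulmx WVP det1 mul1r; reflexivity.
Qed.

(** The characteristic polynomial is invariant under conjugation, so its roots, with multiplicity,
    are the entries of any orthogonal diagonalization. *)
Lemma nuclear_normE (R : realType) (n : nat) (B W : 'M[R]_n) (d : 'rV[R]_n) :
  W *m W^T = 1%:M -> W *m (B^T *m B) *m W^T = diag_mx d ->
  nuclear_norm B = \sum_i Num.sqrt (d 0 i).
Proof.
move=> WW WB; pose s := [seq d 0 i | i <- enum 'I_n].
have pE : char_poly (B^T *m B) = \prod_(x <- s) ('X - x%:P).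
  rewrite -(char_poly_conj _ WW) WB char_poly_trig ?diag_mx_is_trig //.
  by rewrite big_map big_enum /=; apply: eq_bigr => i _; rewrite mxE eqxx.
rewrite /nuclear_norm /singular_values pE big_flatten big_map /=.
have p0 : \prod_(x <- s) ('X - x%:P) != 0.
  by rewrite monic_neq0 // monic_prod_XsubC.
set r := rootsR _.
have r_uniq : uniq r by exact: uniq_roots.
have rE : r =i undup s.
  move=> x; rewrite mem_undup -[RHS]root_prod_XsubC; apply/esym.
  by have /roots_onP := roots_on_rootsR p0; exact.
transitivity (\sum_(x <- s) Num.sqrt x); last by rewrite big_map big_enum.
rewrite (eq_bigr (fun x => Num.sqrt x *+ count_mem x s)) => [|x _]; last first.
  rewrite mu_prod_XsubC big_nseq; elim: (count_mem x s) => [//|k IHk] /=.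
  by rewrite IHk mulrS.
rewrite (perm_big (undup s)) /=; last by rewrite uniq_perm ?undup_uniq.
by rewrite big_undup_iterop_count.
Qed.

(** * The squared Frobenius norm *)

Definition fro2 (R : realType) (m n : nat) (C : 'M[R]_(m, n)) : R :=
  \sum_i \sum_j C i j ^+ 2.

Section Frobenius.
Variable R : realType.

Lemma fro2E (m n : nat) (C : 'M[R]_(m, n)) : fro2 C = \tr (C^T *m C).
Proof.
rewrite /fro2 exchange_big /mxtrace; apply: eq_bigr => j _; rewrite !mxE.
by apply: eq_bigr => i _; rewrite !mxE expr2.
Qed.

Lemma fro2_ge0 (m n : nat) (C : 'M[R]_(m, n)) : 0 <= fro2 C.
Proof. by do 2 (apply: sumr_ge0 => ? _); rewrite sqr_ge0. Qed.

Lemma fro2_eq0 (m n : nat) (C : 'M[R]_(m, n)) : (fro2 C == 0) = (C == 0).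
Proof.
apply/idP/eqP => [|->]; last first.
  by rewrite /fro2 big1 // => i _; rewrite big1 // => j _; rewrite mxE expr0n.
rewrite psumr_eq0 => [/allP C0|i _]; last first.
  by apply: sumr_ge0 => j _; rewrite sqr_ge0.
apply/matrixP => i j; have := C0 i (mem_index_enum _).
rewrite /= psumr_eq0 => [/allP|k _]; last by rewrite sqr_ge0.
by move/(_ j (mem_index_enum _)); rewrite /= mxE sqrf_eq0 => /eqP.
Qed.

Lemma fro2_tr (m n : nat) (C : 'M[R]_(m, n)) : fro2 C^T = fro2 C.
Proof.
by rewrite /fro2 exchange_big; do 2 (apply: eq_bigr => ? _); rewrite mxE.
Qed.

Lemma fro2B (m n : nat) (C D : 'M[R]_(m, n)) :
  fro2 (C - D) = fro2 C - \tr (C^T *m D) *+ 2 + fro2 D.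
Proof.
rewrite !fro2E [(C - D)^T]linearB /= mulmxBr !mulmxBl !raddfB /=.
have -> : \tr (D^T *m C) = \tr (C^T *m D).
  by rewrite -mxtrace_tr trmx_mul trmxK.
by rewrite mulr2n; ring.
Qed.

Lemma fro2Z (m n : nat) (a : R) (C : 'M[R]_(m, n)) :
  fro2 (a *: C) = a ^+ 2 * fro2 C.
Proof.
rewrite /fro2 mulr_sumr; apply: eq_bigr => i _; rewrite mulr_sumr.
by apply: eq_bigr => j _; rewrite mxE exprMn.
Qed.

(** Lagrange's identity: the double sum of squares below is twice the difference of the two
    sides. *)
Lemma sum_cauchy_schwarz (I : finType) (a b : I -> R) :
  (\sum_i a i * b i) ^+ 2 <= (\sum_i a i ^+ 2) * (\sum_i b i ^+ 2).
Proof.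
have : 0 <= \sum_i \sum_j (a i * b j - a j * b i) ^+ 2.
  by do 2 (apply: sumr_ge0 => ? _); rewrite sqr_ge0.
rewrite (eq_bigr (fun i => a i ^+ 2 * (\sum_j b j ^+ 2)
    - 2 * (a i * b i) * (\sum_j a j * b j) + b i ^+ 2 * (\sum_j a j ^+ 2))).
  rewrite big_split sumrB /= -!mulr_suml -mulr_sumr => h.
  by rewrite expr2; lra.
move=> i _; rewrite !mulr_sumr -sumrB -big_split /=; apply: eq_bigr => j _.
by ring.
Qed.

Lemma fro2_mul (m n p : nat) (C : 'M[R]_(m, n)) (D : 'M[R]_(n, p)) :
  fro2 (C *m D) <= fro2 C * fro2 D.
Proof.
rewrite -(fro2_tr D) /fro2 mulr_suml; apply: ler_sum => i _.
rewrite mulr_sumr; apply: ler_sum => j _; rewrite mxE.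
rewrite (le_trans (sum_cauchy_schwarz _ _)) // ler_wpM2l //.
  by apply: sumr_ge0 => k _; rewrite sqr_ge0.
by rewrite le_eqVlt; apply/orP; left; apply/eqP/eq_bigr => k _; rewrite mxE.
Qed.

Lemma fro2_mul_orthogonal (m n : nat) (C : 'M[R]_(m, n)) (W : 'M[R]_n) :
  W *m W^T = 1%:M -> fro2 (C *m W^T) = fro2 C.
Proof.
move=> WW; rewrite !fro2E trmx_mul trmxK mxtrace_mulC mulmxA -(mulmxA C).
by rewrite (mulmx1C WW) mulmx1 mxtrace_mulC.
Qed.

(* At [y = 0] the inverse is [0], and both sides are [fro2 C]. *)
Lemma fro2_reject (m n : nat) (y : 'cV[R]_m) (C : 'M[R]_(m, n)) :
  fro2 (C - (fro2 y)^-1 *: (y *m (y^T *m C)))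
  = fro2 C - fro2 (y^T *m C) / fro2 y.
Proof.
rewrite fro2B fro2Z -scalemxAr linearZ /=.
have -> : \tr (C^T *m (y *m (y^T *m C))) = fro2 (y^T *m C).
  by rewrite fro2E trmx_mul trmxK !mulmxA.
have -> : fro2 (y *m (y^T *m C)) = fro2 y * fro2 (y^T *m C).
  rewrite fro2E trmx_mul -mulmxA (mulmxA y^T).
  have -> : y^T *m y = (fro2 y)%:M.
    rewrite [LHS]mx11_scalar fro2E; congr (_%:M).
    by rewrite /mxtrace big_ord1.
  by rewrite mul_scalar_mx -scalemxAr linearZ /= -fro2E.
have [->|y0] := eqVneq (fro2 y) 0; first by rewrite invr0; ring.
by field.
Qed.

Lemma fro2_reject_le (m n : nat) (y : 'cV[R]_m) (C : 'M[R]_(m, n)) :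
  fro2 (C - (fro2 y)^-1 *: (y *m (y^T *m C))) <= fro2 C.
Proof. by rewrite fro2_reject gerBl divr_ge0 ?fro2_ge0. Qed.

Lemma fro2_orthonormal_compl (m n p : nat) (Q : 'M[R]_(m, p)) (C : 'M[R]_(m, n)) :
  Q^T *m Q = 1%:M -> fro2 ((1%:M - Q *m Q^T) *m C) <= fro2 C.
Proof.
move=> QQ; rewrite mulmxBl mul1mx fro2B.
have -> : \tr (C^T *m (Q *m Q^T *m C)) = fro2 (Q^T *m C).
  by rewrite fro2E trmx_mul trmxK !mulmxA.
have -> : fro2 (Q *m Q^T *m C) = fro2 (Q^T *m C).
  rewrite !fro2E; congr (\tr _); rewrite !trmx_mul !trmxK !mulmxA.
  by rewrite -(mulmxA _ Q^T Q) QQ mulmx1.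
by have := fro2_ge0 (Q^T *m C); rewrite mulr2n; lra.
Qed.

End Frobenius.

(** * Rademacher matrices *)

Definition rademacher_mean (R : realType) (n q : nat) (F : 'M[R]_(n, q) -> R) : R :=
  (\sum_(S : 'M[bool]_(n, q)) F (sign_mx R S)) / #|{: 'M[bool]_(n, q)}|%:R.


Section Rademacher.
Variable R : realType.

Section Matrix.
Variables n q : nat.
Implicit Types F H : 'M[R]_(n, q) -> R.

Let card_neq0 : #|{: 'M[bool]_(n, q)}|%:R != 0 :> R.
Proof. by rewrite pnatr_eq0 -lt0n; apply/card_gt0P; exists (const_mx true). Qed.

Lemma rademacher_mean_le F H :
  (forall S, F S <= H S) -> rademacher_mean F <= rademacher_mean H.
Proof. by move=> FH; rewrite ler_wpM2r ?invr_ge0 ?ler0n // ler_sum. Qed.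

Lemma rademacher_mean_ext F H : F =1 H -> rademacher_mean F = rademacher_mean H.
Proof. by move=> FH; congr (_ / _); apply: eq_bigr => S _; rewrite FH. Qed.

Lemma rademacher_mean_cst c : rademacher_mean (fun _ : 'M[R]_(n, q) => c) = c.
Proof. by rewrite /rademacher_mean sumr_const -[c *+ _]mulr_natr mulfK. Qed.

Lemma rademacher_meanD F H :
  rademacher_mean (fun S => F S + H S) = rademacher_mean F + rademacher_mean H.
Proof. by rewrite /rademacher_mean big_split mulrDl. Qed.

Lemma rademacher_meanZ c F :
  rademacher_mean (fun S => c * F S) = c * rademacher_mean F.
Proof. by rewrite /rademacher_mean -mulr_sumr mulrA. Qed.

Lemma rademacher_mean_sum (I : finType) (F : I -> 'M[R]_(n, q) -> R) :
  rademacher_mean (fun S => \sum_i F i S) = \sum_i rademacher_mean (F i).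
Proof. by rewrite /rademacher_mean exchange_big mulr_suml. Qed.

End Matrix.

Lemma rademacher_mean0 (n : nat) (F : 'M[R]_(n, 0) -> R) :
  rademacher_mean F = F 0.
Proof.
rewrite (@rademacher_mean_ext _ _ _ (fun=> F 0)) ?rademacher_mean_cst // => S.
by congr F; apply/matrixP => i [].
Qed.

(** Independence of the columns: concatenation is a bijection on sign matrices. This drives the
    inductions on the number of columns. *)
Lemma rademacher_mean_split (n q : nat) (F : 'M[R]_(n, q.+1) -> R) :
  rademacher_mean F =
  rademacher_mean (fun s : 'M[R]_(n, 1) =>
    rademacher_mean (fun S : 'M[R]_(n, q) => F (row_mx s S : 'M[R]_(n, 1 + q)))).
Proof.
rewrite /rademacher_mean -mulr_suml -mulrA -invfM -natrM; congr (_ / _%:R); last first.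
  by rewrite !card_mx -!expnD -mulnDr addnC.
rewrite (pair_bigA _ (fun (s : 'M[bool]_(n, 1)) (S : 'M[bool]_(n, q)) =>
  F (row_mx (sign_mx R s) (sign_mx R S) : 'M[R]_(n, 1 + q)))) /=.
rewrite (reindex (fun p : 'M[bool]_(n, 1) * 'M[bool]_(n, q) =>
   row_mx p.1 p.2 : 'M[bool]_(n, 1 + q))) /=.
  by apply: eq_bigr => p _; rewrite -map_row_mx.
exists (fun S : 'M[bool]_(n, 1 + q) => (lsubmx S, rsubmx S)) => [[s S]|S] _ /=.
  by rewrite row_mxKl row_mxKr.
by rewrite hsubmxK.
Qed.

End Rademacher.

(** * Moments of sign vectors and Hutchinson's estimator *)

Section RademacherMoments.
Variables (R : realType) (n : nat).
Implicit Types s : 'cV[R]_n.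

Lemma rademacher_sqr (F : 'cV[R]_n -> R) a :
  rademacher_mean (fun s => s a 0 * s a 0 * F s) = rademacher_mean F.
Proof.
congr (_ / _); apply: eq_bigr => s _; rewrite mxE -expr2 sqrr_sign mul1r.
reflexivity.
Qed.

(** Flipping the sign of coordinate [a] permutes the sign vectors, so the mean equals its own
    opposite. *)
Lemma rademacher_mean_odd (F : 'cV[R]_n -> R) a :
  (forall s, F (\col_i ((-1) ^+ (i == a) * s i 0)) = - F s) ->
  rademacher_mean F = 0.
Proof.
move=> Fodd; suff : rademacher_mean F = - rademacher_mean F by lra.
rewrite {1}/rademacher_mean /rademacher_mean -mulNr -sumrN; congr (_ / _).
pose flip (s : 'cV[bool]_n) := \col_i ((i == a) (+) s i 0).
have flipK : involutive flip.
  move=> s; apply/matrixP => i j; rewrite ord1 !mxE addbA addbb.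
  by [].
rewrite (reindex_inj (inv_inj flipK)); apply: eq_bigr => s _; rewrite -Fodd.
by congr F; apply/matrixP => i j; rewrite ord1 !mxE signr_addb.
Qed.

Lemma rademacher_moment2 (a b : 'I_n) :
  rademacher_mean (fun s => s a 0 * s b 0) = (a == b)%:R.
Proof.
have [<-|ab] := eqVneq a b.
  transitivity (rademacher_mean (fun s => s a 0 * s a 0 * 1)).
    by apply: rademacher_mean_ext => s; rewrite mulr1.
  by rewrite (rademacher_sqr (fun=> 1)) rademacher_mean_cst.
apply: (@rademacher_mean_odd _ a) => s.
by rewrite !mxE eqxx eq_sym (negbTE ab) expr1 expr0; ring.
Qed.

(** A product of four signs has mean 1 if the indices can be paired off and 0 otherwise. Each of the
    three pairings contributes a term; when all four indices agree the three overlap, and the last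
    term takes the excess 2 away. *)
Lemma rademacher_moment4 (a b c d : 'I_n) :
  rademacher_mean (fun s => s a 0 * s b 0 * (s c 0 * s d 0)) =
  (a == b)%:R * (c == d)%:R + (a == c)%:R * (b == d)%:R
  + (a == d)%:R * (b == c)%:R - (a == b)%:R * (a == c)%:R * (a == d)%:R *+ 2.
Proof.
have [<-|ab] := eqVneq a b.
  by rewrite rademacher_sqr rademacher_moment2 mulr1n; ring.
have [<-|ac] := eqVneq a c.
  rewrite [b == a]eq_sym (negbTE ab).
  rewrite !(mul0r, mulr0, addr0, add0r, mul1r, mul0rn, oppr0).
  rewrite -rademacher_moment2 -[RHS](rademacher_sqr _ a).
  by apply: rademacher_mean_ext => s; ring.
have [<-|ad] := eqVneq a d.
  rewrite !(mul0r, mulr0, addr0, add0r, mul1r, mul0rn, oppr0).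
  rewrite -rademacher_moment2 -[RHS](rademacher_sqr _ a).
  by apply: rademacher_mean_ext => s; ring.
rewrite !(mul0r, mulr0, addr0, add0r, mul1r, mul0rn, oppr0).
apply: (@rademacher_mean_odd _ a) => s.
rewrite !mxE eqxx ![_ == a]eq_sym (negbTE ab) (negbTE ac) (negbTE ad).
by rewrite expr1 expr0; ring.
Qed.

Lemma quad_formE (X : 'M[R]_n) s :
  \tr (s^T *m X *m s) = \sum_a \sum_b X a b * (s a 0 * s b 0).
Proof.
rewrite /mxtrace big_ord1 mxE exchange_big; apply: eq_bigr => b _.
rewrite mxE mulr_suml; apply: eq_bigr => a _; rewrite mxE; ring.
Qed.

Lemma rademacher_quad (X : 'M[R]_n) :
  rademacher_mean (fun s => \tr (s^T *m X *m s)) = \tr X.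
Proof.
under rademacher_mean_ext do rewrite quad_formE.
rewrite rademacher_mean_sum; apply: eq_bigr => a _.
rewrite rademacher_mean_sum (bigD1 a) //= big1 ?addr0 => [|b ba].
  by rewrite rademacher_meanZ rademacher_moment2 eqxx mulr1.
by rewrite rademacher_meanZ rademacher_moment2 eq_sym (negbTE ba) mulr0.
Qed.

(** Each pairing in [rademacher_moment4] yields one of the three trace terms; the diagonal sum is
    the correction for four equal indices. *)
Lemma rademacher_quad_mul (X Y : 'M[R]_n) :
  rademacher_mean (fun s => \tr (s^T *m X *m s) * \tr (s^T *m Y *m s)) =
  \tr X * \tr Y + \tr (X^T *m Y) + \tr (X *m Y) - (\sum_a X a a * Y a a) *+ 2.
Proof.
have pick (F : 'I_n -> R) a : \sum_b F b * (a == b)%:R = F a.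
  rewrite (bigD1 a) //= eqxx mulr1 big1 ?addr0 // => b ba.
  by rewrite eq_sym (negbTE ba) mulr0.
have pickl (F : 'I_n -> R) a : \sum_b (a == b)%:R * F b = F a.
  by under eq_bigr do rewrite mulrC; rewrite pick.
transitivity (\sum_a \sum_b X a b * ((a == b)%:R * \tr Y + Y a b + Y b a
    - (a == b)%:R * Y a a *+ 2)).
  under rademacher_mean_ext do rewrite !quad_formE mulr_suml.
  rewrite rademacher_mean_sum; apply: eq_bigr => a _.
  under rademacher_mean_ext do rewrite mulr_suml.
  rewrite rademacher_mean_sum; apply: eq_bigr => b _.
  under rademacher_mean_ext do rewrite -mulrA.
  rewrite rademacher_meanZ; congr (_ * _).
  under rademacher_mean_ext do rewrite mulr_sumr.
  rewrite rademacher_mean_sum.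
  transitivity (\sum_c ((a == b)%:R * Y c c + (a == c)%:R * Y c b + Y c a * (b == c)%:R
    - (a == b)%:R * ((a == c)%:R * Y c a) *+ 2)); last first.
    by rewrite sumrB !big_split /= -!mulr_sumr pick !pickl -/(\tr Y); ring.
  apply: eq_bigr => c _.
  transitivity (\sum_d (Y c d * (c == d)%:R * (a == b)%:R + (a == c)%:R * (Y c d * (b == d)%:R)
    + Y c d * (a == d)%:R * (b == c)%:R
    - (Y c d * (a == d)%:R) * ((a == b)%:R * (a == c)%:R) *+ 2)).
    under rademacher_mean_ext do rewrite mulr_sumr.
    rewrite rademacher_mean_sum; apply: eq_bigr => d _.
    transitivity (Y c d * rademacher_mean (fun s => s a 0 * s b 0 * (s c 0 * s d 0))).
      by rewrite -rademacher_meanZ; apply: rademacher_mean_ext => s; ring.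
    by rewrite rademacher_moment4; ring.
  rewrite sumrB !big_split /= -!mulr_suml -mulr_sumr !pick.
  by ring.
rewrite (eq_bigr (fun a => X a a * \tr Y + \sum_b X a b * Y a b + \sum_b X a b * Y b a
   - X a a * Y a a *+ 2)); last first.
  move=> a _; transitivity (\sum_b ((X a b * (a == b)%:R) * \tr Y + X a b * Y a b
    + X a b * Y b a - (X a b * (a == b)%:R) * Y a a *+ 2)).
    by apply: eq_bigr => b _; ring.
  by rewrite sumrB !big_split /= -!mulr_suml !pick.
rewrite sumrB !big_split /= -mulr_suml; congr (_ + _ + _ - _).
  rewrite exchange_big; apply: eq_bigr => a _; rewrite mxE.
  by apply: eq_bigr => b _; rewrite mxE.
by apply: eq_bigr => a _; rewrite mxE.
Qed.

Lemma rademacher_quad_var (Z : 'M[R]_n) :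
  rademacher_mean (fun s => (\tr (s^T *m Z *m s) - \tr Z) ^+ 2) <= 2 * fro2 Z.
Proof.
have -> : rademacher_mean (fun s => (\tr (s^T *m Z *m s) - \tr Z) ^+ 2)
    = fro2 Z + \tr (Z *m Z) - (\sum_a Z a a * Z a a) *+ 2.
  transitivity (rademacher_mean (fun s => \tr (s^T *m Z *m s) * \tr (s^T *m Z *m s)
     + (- 2 * \tr Z * \tr (s^T *m Z *m s) + \tr Z ^+ 2))).
    by apply: rademacher_mean_ext => s; ring.
  rewrite !rademacher_meanD rademacher_meanZ rademacher_mean_cst.
  by rewrite rademacher_quad rademacher_quad_mul fro2E; ring.
have Zdiag : 0 <= \sum_a Z a a * Z a a.
  by apply: sumr_ge0 => a _; rewrite -expr2 sqr_ge0.
have ZZ : \tr (Z *m Z) <= fro2 Z.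
  have := fro2_ge0 (Z - Z^T); rewrite fro2B fro2_tr.
  have -> : \tr (Z^T *m Z^T) = \tr (Z *m Z) by rewrite -trmx_mul mxtrace_tr.
  by rewrite mulr2n; lra.
by rewrite mulr2n; lra.
Qed.

Lemma quad_form_row_mx (Z : 'M[R]_n) (p q : nat) (S : 'M[R]_(n, p)) (G : 'M[R]_(n, q)) :
  \tr ((row_mx S G)^T *m Z *m row_mx S G) =
  \tr (S^T *m Z *m S) + \tr (G^T *m Z *m G).
Proof. by rewrite tr_row_mx mul_col_mx mul_col_row mxtrace_block. Qed.

(** Variances of independent columns add. Both claims are proved together because the zero mean of
    the remaining columns kills the cross term. *)
Lemma rademacher_quad_samples (Z : 'M[R]_n) (q : nat) :
  let D (G : 'M[R]_(n, q)) := \tr (G^T *m Z *m G) - q%:R * \tr Z in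
  rademacher_mean D = 0 /\
  rademacher_mean (fun G => D G ^+ 2) <= q%:R * (2 * fro2 Z).
Proof.
elim: q => [|q [IH1 IH2]] D.
  rewrite !rademacher_mean0 /D mulmx0 mxtrace0 !mul0r subrr expr0n.
  by [].
have DE (s : 'cV[R]_n) (G : 'M[R]_(n, q)) :
    D (row_mx s G : 'M[R]_(n, 1 + q)) =
    (\tr (s^T *m Z *m s) - \tr Z) + (\tr (G^T *m Z *m G) - q%:R * \tr Z).
  by rewrite /D [X in X - _](quad_form_row_mx Z s G) -natr1; ring.
split; rewrite rademacher_mean_split.
  under rademacher_mean_ext => s.
    under rademacher_mean_ext do rewrite DE.
    rewrite rademacher_meanD rademacher_mean_cst IH1 addr0; over.
  rewrite rademacher_meanD rademacher_quad rademacher_mean_cst; ring.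
under rademacher_mean_ext => s.
  under rademacher_mean_ext do rewrite DE sqrrD -mulrnAl.
  rewrite !rademacher_meanD rademacher_mean_cst rademacher_meanZ IH1 mulr0 addr0.
  over.
rewrite rademacher_meanD rademacher_mean_cst -natr1 mulrDl mul1r addrC lerD //.
exact: rademacher_quad_var.
Qed.

End RademacherMoments.

(** * Low-rank approximation by a Rademacher sketch *)

(* The component of [C] orthogonal to the line of [C *m s]; this is [C] when
   [C *m s = 0], the inverse being then [0]. *)
Definition deflate (R : realType) (n : nat) (C : 'M[R]_n) (s : 'cV[R]_n) : 'M[R]_n :=
  C - (fro2 (C *m s))^-1 *: (C *m s *m ((C *m s)^T *m C)).

Fixpoint sketch_residual (R : realType) (n q : nat) :
    'M[R]_(n, q) -> 'M[R]_n -> 'M[R]_n :=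
  match q return 'M[R]_(n, q) -> 'M[R]_n -> 'M[R]_n with
  | 0 => fun _ C => C
  | q'.+1 => fun (S : 'M[R]_(n, 1 + q')) C =>
      sketch_residual (rsubmx S) (deflate C (lsubmx S))
  end.

(** The transition operator of deflation by a fresh sign vector; its [q]-th iterate gives the mean
    after [q] columns. *)
Definition deflation_mean (R : realType) (n : nat) (g : 'M[R]_n -> R) (C : 'M[R]_n) : R :=
  rademacher_mean (fun s => g (deflate C s)).

Section Sketch.
Variables (R : realType) (n : nat).
Implicit Types C : 'M[R]_n.

(** What is subtracted has its columns in the span of [C *m S], hence is killed by the projection
    away from that span. *)
Lemma sketch_residualP (q : nat) (S : 'M[R]_(n, q)) C :
  exists X, sketch_residual S C = C - C *m S *m X.
Proof.
elim: q S C => [|q IHq] S C /=; first by exists 0; rewrite mulmx0 subr0.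
pose s : 'cV[R]_n := @lsubmx R n 1 q S; pose G : 'M[R]_(n, q) := @rsubmx R n 1 q S.
have [X ->] := IHq G (deflate C s); rewrite /deflate.
pose w := (fro2 (C *m s))^-1 *: ((C *m s)^T *m C).
exists (col_mx (w - w *m G *m X) X : 'M[R]_(1 + q, n)).
have SE : S = row_mx s G :> 'M[R]_(n, 1 + q) by rewrite hsubmxK.
have -> : C *m S *m (col_mx (w - w *m G *m X) X : 'M[R]_(1 + q, n))
    = C *m s *m (w - w *m G *m X) + C *m G *m X.
  by rewrite {1}SE (mul_mx_row C s G) (mul_row_col (C *m s)).
rewrite scalemxAr -/w mulmxBr !mulmxBl !mulmxA !opprB !opprD.
by rewrite opprK !addrA.
Qed.

Lemma sketch_residual_mean (q : nat) (g : 'M[R]_n -> R) C :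
  rademacher_mean (fun S : 'M[R]_(n, q) => g (sketch_residual S C))
  = iter q (@deflation_mean R n) g C.
Proof.
elim: q C => [|q IHq] C; first by rewrite rademacher_mean0.
rewrite rademacher_mean_split iterS /deflation_mean.
apply: rademacher_mean_ext => s /=; rewrite -IHq; apply: rademacher_mean_ext => S.
by rewrite row_mxKl row_mxKr.
Qed.

Lemma fro2_mul_row C (W : 'M[R]_n) i :
  fro2 (C *m (row i W)^T) = (W *m (C^T *m C) *m W^T) i i.
Proof.
have -> : W *m (C^T *m C) *m W^T = (C *m W^T)^T *m (C *m W^T).
  by rewrite trmx_mul trmxK !mulmxA.
rewrite [RHS]mxE; apply: eq_bigr => k _.
have -> : (C *m W^T)^T i k = (C *m W^T) k i by rewrite mxE.
rewrite big_ord1 expr2; suff -> : (C *m (row i W)^T) k 0 = (C *m W^T) k i by [].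
by rewrite !mxE; apply: eq_bigr => j _; rewrite !mxE.
Qed.

Lemma trace_gram_sqr C : \tr ((C^T *m C) *m (C^T *m C)) = fro2 (C^T *m C).
Proof. by rewrite fro2E trmx_mul trmxK. Qed.

(* [1 / y >= 2 t - t ^ 2 y] reduces the mean of the ratio
   [s^T M^2 s / s^T M s], [M = C^T C], to fourth moments; then [t = 1 / (3 \tr M)]. *)
Lemma deflation_mean_fro2 C :
  deflation_mean (@fro2 R n n) C
  <= fro2 C - fro2 (C^T *m C) / (3 * fro2 C).
Proof.
have [M ME] : exists M, M = C^T *m C by eexists.
rewrite -ME; pose t := (3 * fro2 C)^-1.
have MT : M^T = M by rewrite ME trmx_mul trmxK.
have YE s : fro2 (C *m s) = \tr (s^T *m M *m s).
  by rewrite fro2E trmx_mul ME !mulmxA.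
have XE s : fro2 ((C *m s)^T *m C) = \tr (s^T *m (M *m M) *m s).
  by rewrite -fro2_tr fro2E trmxK !trmx_mul !trmxK ME !mulmxA.
have step s : fro2 (deflate C s) <= fro2 C + ((- 2 * t) * \tr (s^T *m (M *m M) *m s)
    + t ^+ 2 * (\tr (s^T *m (M *m M) *m s) * \tr (s^T *m M *m s))).
  rewrite /deflate fro2_reject -YE -XE lerD2l.
  have [y0|y0] := eqVneq (fro2 (C *m s)) 0.
    have /eqP -> : C *m s == 0 by rewrite -fro2_eq0 y0.
    have -> : fro2 ((0 : 'cV[R]_n)^T *m C) = 0.
      by apply/eqP; rewrite fro2_eq0 trmx0 mul0mx.
    by rewrite !mul0r !mulr0 addr0 oppr0.
  have y_gt0 : 0 < fro2 (C *m s) by rewrite lt_def y0 fro2_ge0.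
  set x := fro2 (_ *m C); set y := fro2 _ in y0 y_gt0 *.
  have x_ge0 : 0 <= x by exact: fro2_ge0.
  rewrite -subr_ge0.
  have -> : - 2 * t * x + t ^+ 2 * (x * y) - - (x / y) = x / y * (1 - t * y) ^+ 2.
    by field.
  by rewrite mulr_ge0 ?sqr_ge0 // divr_ge0 // ltW.
apply: le_trans (rademacher_mean_le step) _.
rewrite !rademacher_meanD !rademacher_meanZ rademacher_mean_cst rademacher_quad.
rewrite rademacher_quad_mul trmx_mul MT lerD2l.
have -> : \tr (M *m M) = fro2 M by rewrite ME trace_gram_sqr.
have -> : \tr M = fro2 C by rewrite fro2E ME.
(* [\tr (M *m M *m M)] is the squared norm of [C *m M], so submultiplicativity bounds it; the mean
   of the product of the two forms is then at most [3 * fro2 C * fro2 M]. *)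
have M3 : \tr (M *m M *m M) <= fro2 C * fro2 M.
  rewrite -[X in X *m M *m M]MT.
  have -> : \tr (M^T *m M *m M) = fro2 (C *m M).
    by rewrite fro2E trmx_mul mulmxA -[_ *m C^T *m C]mulmxA -ME.
  exact: fro2_mul.
have diag : 0 <= \sum_a (M *m M) a a * M a a.
  have gram_diag (X : 'M[R]_n) a : 0 <= (X^T *m X) a a.
    by rewrite mxE; apply: sumr_ge0 => k _; rewrite mxE -expr2 sqr_ge0.
  apply: sumr_ge0 => a _; rewrite mulr_ge0 //; last by rewrite ME.
  by rewrite -[X in (X *m M) a a]MT.
clear step; set f := fro2 C in t M3 *; set g := fro2 M in M3 *.
have f_ge0 : 0 <= f by exact: fro2_ge0.
have g_ge0 : 0 <= g by exact: fro2_ge0.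
set d := \sum_a _ in diag *; set m3 := \tr _ in M3 *.
have : t ^+ 2 * (g * f + m3 + m3 - d *+ 2) <= t ^+ 2 * (3 * f * g).
  by rewrite ler_wpM2l ?sqr_ge0 // mulr2n; lra.
have [f0|f0] := eqVneq f 0.
  have -> : t = 0 by rewrite /t f0 mulr0 invr0.
  by rewrite f0 !(mulr0, mul0r, expr0n, invr0, oppr0, addr0).
have -> : t ^+ 2 * (3 * f * g) = g / (3 * f) by rewrite /t; field.
have -> : - 2 * t * g = - (g / (3 * f)) *+ 2 by rewrite /t; field.
by rewrite mulr2n; lra.
Qed.

(** * Residuals of a matrix of bounded nuclear norm *)

Section Dominated.
Variables (W : 'M[R]_n) (sigma : 'I_n -> R) (N : R).
Hypothesis WW : W *m W^T = 1%:M.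
Hypothesis sigma_ge0 : forall i, 0 <= sigma i.
Hypothesis sigma_sum : \sum_i sigma i <= N.

(** [sigma] stands for the singular values of the sketched matrix, the rows of [W] for its right
    singular vectors. This invariant of deflation takes the place of a nuclear norm bound on each
    residual. *)
Definition dominated C := forall i, fro2 (C *m (row i W)^T) <= sigma i ^+ 2.

(** Deflation multiplies on the left by an orthogonal projection, which lengthens no vector
    [C *m (row i W)^T]. *)
Lemma dominated_deflate C s : dominated C -> dominated (deflate C s).
Proof.
move=> domC i; apply: le_trans (domC i).
have -> : deflate C s *m (row i W)^T
    = C *m (row i W)^T - (fro2 (C *m s))^-1 *:
      (C *m s *m ((C *m s)^T *m (C *m (row i W)^T))).
  by rewrite mulmxBl -scalemxAl -!mulmxA.
exact: fro2_reject_le.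
Qed.

(* Hoelder's inequality between the Schatten norms of orders 1, 2 and 4. *)
Lemma dominated_interpolation C : dominated C ->
  fro2 C ^+ 3 <= N ^+ 2 * fro2 (C^T *m C).
Proof.
move=> domC; pose e i := Num.sqrt (fro2 (C *m (row i W)^T)).
have e_ge0 i : 0 <= e i by exact: sqrtr_ge0.
have e2 i : e i ^+ 2 = (W *m (C^T *m C) *m W^T) i i.
  by rewrite sqr_sqrtr ?fro2_ge0 // fro2_mul_row.
have e_le i : e i <= sigma i.
  by rewrite -[sigma i]ger0_norm // -sqrtr_sqr ler_wsqrtr.
have f_eq : fro2 C = \sum_i e i ^+ 2.
  rewrite -(fro2_mul_orthogonal C WW) fro2E /mxtrace; apply: eq_bigr => i _.
  by rewrite e2 trmx_mul trmxK !mulmxA.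
(* Only diagonal entries are kept, since [W] need not diagonalize the Gram matrix of a residual. *)
have g_ge : \sum_i (e i ^+ 2) ^+ 2 <= fro2 (C^T *m C).
  rewrite -(fro2_mul_orthogonal _ WW) -fro2_tr -(fro2_mul_orthogonal _ WW) -fro2_tr.
  rewrite trmx_mul trmxK trmxK mulmxA; apply: ler_sum => i _.
  rewrite e2 (bigD1 i) //= lerDl; apply: sumr_ge0 => j _; exact: sqr_ge0.
(* Cauchy-Schwarz with [e^2 = e^(1/2) * e^(3/2)], and in [cs2] with [e^3 = e * e^2]. *)
have cs1 : (\sum_i e i ^+ 2) ^+ 2 <= N * \sum_i e i ^+ 3.
  have := sum_cauchy_schwarz (fun i => Num.sqrt (e i)) (fun i => Num.sqrt (e i) * e i).
  rewrite (eq_bigr (fun i => e i ^+ 2)) => [|i _]; last first.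
    by rewrite mulrA -expr2 sqr_sqrtr // expr2.
  move/le_trans; apply; rewrite ler_pM //.
  - by apply: sumr_ge0 => i _; rewrite sqr_ge0.
  - by apply: sumr_ge0 => i _; rewrite sqr_ge0.
  - apply: le_trans sigma_sum; apply: ler_sum => i _; rewrite sqr_sqrtr //.
  - by apply: ler_sum => i _; rewrite exprMn sqr_sqrtr // -exprS.
have cs2 : (\sum_i e i ^+ 3) ^+ 2 <= (\sum_i e i ^+ 2) * \sum_i (e i ^+ 2) ^+ 2.
  have := sum_cauchy_schwarz e (fun i => e i ^+ 2).
  by under eq_bigr do rewrite -exprS.
have [f0|f0] := eqVneq (fro2 C) 0.
  by rewrite f0 expr0n /= mulr_ge0 ?sqr_ge0 ?fro2_ge0.
have f_gt0 : 0 < fro2 C by rewrite lt_def f0 fro2_ge0.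
have N_ge0 : 0 <= N by apply: le_trans sigma_sum; apply: sumr_ge0.
(* With [f = fro2 C] and [g = fro2 (C^T *m C)], multiplication by [f] turns the claim into
   [(f^2)^2 <= N^2 * (f * g)], which is [cs1] squared followed by [cs2]. *)
rewrite -(ler_pM2l f_gt0) -exprS (exprM _ 2 2) mulrCA.
apply: (@le_trans _ _ ((N * \sum_i e i ^+ 3) ^+ 2)).
  rewrite lerXn2r ?nnegrE ?sqr_ge0 ?mulr_ge0 //; last by rewrite f_eq.
  by apply: sumr_ge0 => i _; rewrite exprn_ge0.
rewrite exprMn ler_wpM2l ?sqr_ge0 // (le_trans cs2) // -f_eq.
by rewrite ler_wpM2l ?fro2_ge0.
Qed.

(** Averaging is monotone and affine, and deflation preserves [dominated], so a pointwise comparison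
    passes through any number of columns. *)
Lemma iter_deflation_mean_le (q : nat) (g h : 'M[R]_n -> R) (a b : R) :
  (forall C, dominated C -> g C <= a * h C + b) ->
  forall C, dominated C ->
  iter q (@deflation_mean R n) g C <= a * iter q (@deflation_mean R n) h C + b.
Proof.
move=> gh; elim: q => [|q IHq] C domC; first exact: gh.
rewrite !iterS /deflation_mean -rademacher_meanZ.
rewrite -[X in _ + X](@rademacher_mean_cst R n 1) -rademacher_meanD.
by apply: rademacher_mean_le => s; apply/IHq/dominated_deflate.
Qed.

(** With [D = 3 * N^2] the mean residual obeys [x' <= x - x^2 / D], which keeps it below [D / q].
    Each step is bounded by an affine tangent, which commutes with the mean. *)
Lemma sketch_residual_bound (q : nat) C : 0 < N -> dominated C ->
  q%:R * rademacher_mean (fun S : 'M[R]_(n, q) => fro2 (sketch_residual S C))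
  <= 3 * N ^+ 2.
Proof.
move=> N_gt0 domC; pose D := 3 * N ^+ 2.
have D_gt0 : 0 < D by rewrite mulr_gt0 ?exprn_gt0.
have step (tau : R) : forall C0, dominated C0 ->
    deflation_mean (@fro2 R n n) C0 <= (1 - 2 * tau / D) * fro2 C0 + tau ^+ 2 / D.
  move=> {domC}C dom; apply: le_trans (deflation_mean_fro2 C) _.
  have := dominated_interpolation dom.
  set f := fro2 C; set g := fro2 _ => fg.
  have f_ge0 : 0 <= f by exact: fro2_ge0.
  (* The tangent at [tau] to the concave function [f - f^2 / D] lies above it by
     [(f - tau)^2 / D]. *)
  suff : f ^+ 2 / D <= g / (3 * f).
    have : 0 <= (f - tau) ^+ 2 / D by rewrite divr_ge0 ?sqr_ge0 // ltW.
    have -> : (f - tau) ^+ 2 / D = f ^+ 2 / D - 2 * tau / D * f + tau ^+ 2 / D.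
      by rewrite sqrrB; ring.
    by rewrite mulrBl; lra.
  have [f0|f0] := eqVneq f 0; first by rewrite f0 mulr0 invr0 mulr0 expr0n mul0r.
  have f_gt0 : 0 < f by rewrite lt_def f0.
  rewrite ler_pdivrMr // mulrAC ler_pdivlMr ?mulr_gt0 //.
  by rewrite /D; move: fg; rewrite exprS; lra.
rewrite (sketch_residual_mean _ (@fro2 R n n)) -/D.
elim: q => [|q IHq]; first by rewrite mul0r ltW.
(* The extra column comes last, so [step] applies inside the mean over the first [q] columns. *)
rewrite iterSr; set x := iter q _ _ _ in IHq.
(* [x - x^2 / D] is estimated through its tangent at [tau]. *)
pose tau : R := D / q.+1%:R.
apply: (@le_trans _ _ (q.+1%:R * ((1 - 2 * tau / D) * x + tau ^+ 2 / D))).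
  by rewrite ler_wpM2l ?ler0n //; apply: iter_deflation_mean_le domC; exact: step.
have -> : (1 - 2 * tau / D) * x + tau ^+ 2 / D
    = ((q.+1%:R - 2) * x + D / q.+1%:R) / q.+1%:R.
  by rewrite /tau; field; rewrite addrC natr1 pnatr_eq0 (gt_eqF D_gt0).
rewrite mulrC divfK ?pnatr_eq0 // -natr1.
have x_ge0 : 0 <= x.
  rewrite /x -sketch_residual_mean -(@rademacher_mean_cst R n q 0).
  by apply: rademacher_mean_le => S; exact: fro2_ge0.
(* For the first column the coefficient of [x] is negative and [0 <= x] is used; afterwards it is
   nonnegative and the induction hypothesis bounds [x]. *)
case: q @x IHq @tau x_ge0 => [|q] x IHq tau x_ge0.
  by rewrite add0r divr1; lra.
have q_gt0 : 0 < q.+1%:R :> R by rewrite ltr0n.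
have : D / (q.+1%:R + 1) <= D / q.+1%:R.
  by rewrite ler_pM2l // lef_pV2 ?posrE ?addr_gt0 // lerDl.
have : (q.+1%:R - 1) * x <= (q.+1%:R - 1) * (D / q.+1%:R).
  apply: ler_wpM2l; first by rewrite -natr1 addrK ler0n.
  by rewrite ler_pdivlMr // mulrC.
have -> : (q.+1%:R - 1) * (D / q.+1%:R) = D - D / q.+1%:R.
  by field; rewrite addrC natr1 pnatr_eq0.
have -> : q.+1%:R + 1 - 2 = q.+1%:R - 1 :> R by ring.
move: (_ * x) (D / _) (D / _) => u v w; lra.
Qed.


End Dominated.
End Sketch.

(** * The Hutch++ estimator *)

Section Hutchpp.
Variables (R : realType) (n : nat).

(** At the start [dominated] holds with equality, for an eigenbasis of [B^T *m B] and the square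
    roots of its eigenvalues. *)
Lemma sketch_residual_nuclear (q : nat) (B : 'M[R]_n) (N : R) :
  0 < N -> nuclear_norm B <= N ->
  q%:R * rademacher_mean (fun S : 'M[R]_(n, q) => fro2 (sketch_residual S B))
  <= 3 * N ^+ 2.
Proof.
move=> N_gt0 BN; have BBsym : (B^T *m B)^T = B^T *m B by rewrite trmx_mul trmxK.
have [W [d [WW Wd]]] := spectral_theorem_real BBsym.
apply: (@sketch_residual_bound _ _ W (fun i => Num.sqrt (d 0 i))) => // [i||i].
- exact: sqrtr_ge0.
- by rewrite -(nuclear_normE WW Wd).
have dE : fro2 (B *m (row i W)^T) = d 0 i.
  by rewrite fro2_mul_row Wd mxE eqxx.
by rewrite sqr_sqrtr -dE // fro2_ge0.
Qed.

(** The right-hand projection can only decrease the norm. The left-hand one kills [B *m S *m X], so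
    [B] may be replaced by its residual, and it contracts as well. *)
Lemma fro2_projected_residual (q p : nat) (B : 'M[R]_n) (S : 'M[R]_(n, q))
    (Q : 'M[R]_(n, p)) : Q^T *m Q = 1%:M -> (Q^T :=: (B *m S)^T)%MS ->
  fro2 ((1%:M - Q *m Q^T) *m B *m (1%:M - Q *m Q^T)) <= fro2 (sketch_residual S B).
Proof.
move=> QQ QY; have PT : (1%:M - Q *m Q^T)^T = 1%:M - Q *m Q^T.
  by rewrite linearB /= trmx1 trmx_mul trmxK.
rewrite -fro2_tr trmx_mul PT; apply: le_trans (fro2_orthonormal_compl _ QQ) _.
rewrite fro2_tr; have [X ->] := sketch_residualP S B.
suff -> : (1%:M - Q *m Q^T) *m B = (1%:M - Q *m Q^T) *m (B - B *m S *m X).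
  exact: fro2_orthonormal_compl.
have /submxP[D YD] : ((B *m S)^T <= Q^T)%MS by rewrite QY.
have -> : B *m S = Q *m D^T by rewrite -[LHS]trmxK YD trmx_mul trmxK.
rewrite [RHS]mulmxBr !mulmxA; set T := _ *m X; suff -> : T = 0 by rewrite subr0.
by rewrite /T mulmxBl mul1mx -(mulmxA Q) QQ mulmx1 subrr !mul0mx.
Qed.

Variables (orth : orthonormalizer R n) (l : nat).
Hypothesis orthP : orthonormalizes orth.
Let q := (l %/ 3)%N.
Hypothesis q_gt0 : (0 < q)%N.
Hypothesis lE : l = (3 * q)%N.

(** The trace on the span of [Q] is computed exactly and [P] is idempotent, so the error is that of
    Hutchinson's estimator on [P *m B *m P]. *)
Lemma hutchpp_valueE (B : 'M[R]_n) (S G : 'M[R]_(n, q)) :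
  let P := 1%:M - orth (B *m S) *m (orth (B *m S))^T in
  @hutchpp_value R n orth l B S G - \tr B =
  q%:R^-1 * (\tr (G^T *m (P *m B *m P) *m G) - q%:R * \tr (P *m B *m P)).
Proof.
move=> P; have [QQ _] := orthP (B *m S); rewrite /hutchpp_value.
set Q := orth (B *m S) in P QQ *.
have PP : P *m P = P.
  rewrite /P mulmxBl mul1mx mulmxBr mulmx1 mulmxA -(mulmxA Q) QQ mulmx1.
  by rewrite subrr subr0.
have trP : \tr (P *m B *m P) = \tr B - \tr (Q^T *m B *m Q).
  rewrite mxtrace_mulC mulmxA PP /P mulmxBl mul1mx raddfB /=; congr (_ - _).
  by rewrite mxtrace_mulC mulmxA -mxtrace_mulC mulmxA.
have q0 : q%:R != 0 :> R by rewrite pnatr_eq0 -lt0n.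
have -> : 3 / l%:R = q%:R^-1 :> R.
  by rewrite lE natrM invfM mulrA divff ?mul1r // pnatr_eq0.
by rewrite -/P mulrBr mulKf // trP !mulmxA; ring.
Qed.

Lemma hutchpp_value_unbiased (B : 'M[R]_n) :
  rademacher_mean (fun S => rademacher_mean (fun G =>
    @hutchpp_value R n orth l B S G - \tr B)) = 0.
Proof.
rewrite -[RHS](@rademacher_mean_cst R n q); apply: rademacher_mean_ext => S.
under rademacher_mean_ext do rewrite hutchpp_valueE.
by rewrite rademacher_meanZ (rademacher_quad_samples _ _).1 mulr0.
Qed.

Lemma hutchpp_value_var (B : 'M[R]_n) (N : R) :
  0 < N -> nuclear_norm B <= N ->
  rademacher_mean (fun S => rademacher_mean (fun G =>
    (@hutchpp_value R n orth l B S G - \tr B) ^+ 2)) <= 6 * N ^+ 2 / q%:R ^+ 2.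
Proof.
move=> N_gt0 BN; have q0 : 0 < q%:R :> R by rewrite ltr0n.
apply: (@le_trans _ _ (rademacher_mean (fun S : 'M[R]_(n, q) =>
    2 / q%:R * fro2 (sketch_residual S B)))).
  apply: rademacher_mean_le => S.
  under rademacher_mean_ext do rewrite hutchpp_valueE exprMn.
  set Q := orth (B *m S); set Z := _ *m B *m _.
  rewrite rademacher_meanZ.
  apply: (@le_trans _ _ (q%:R^-1 ^+ 2 * (q%:R * (2 * fro2 Z)))).
    by rewrite ler_wpM2l ?sqr_ge0 //; exact: (rademacher_quad_samples Z q).2.
  have -> : q%:R^-1 ^+ 2 * (q%:R * (2 * fro2 Z)) = 2 / q%:R * fro2 Z.
    by field; rewrite gt_eqF.
  rewrite ler_wpM2l ?divr_ge0 ?ler0n //.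
  by have [QQ QY] := orthP (B *m S); exact: fro2_projected_residual.
rewrite rademacher_meanZ; have := sketch_residual_nuclear q N_gt0 BN.
set x := rademacher_mean _ => xN.
have -> : 2 / q%:R * x = 2 / q%:R ^+ 2 * (q%:R * x).
  by field; rewrite gt_eqF.
have -> : 6 * N ^+ 2 / q%:R ^+ 2 = 2 / q%:R ^+ 2 * (3 * N ^+ 2) by ring.
by rewrite ler_wpM2l // divr_ge0 // sqr_ge0.
Qed.

End Hutchpp.

(** * Expected values of randomized algorithms *)

Fixpoint expect (R : realType) (n : nat) (X : Type) (A : nat -> 'M[R]_n)
    (p : alg R n X) (F : X -> R) {struct p} : R :=
  match p with
  | Ret x => F x
  | Rademacher q k => rademacher_mean (fun S => expect A (k S) F)
  | MatVec i v k => expect A (k (A i *m v)) F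
  end.

Section Expect.
Variables (R : realType) (n : nat) (A : nat -> 'M[R]_n).

Lemma Pr_expect (X : Type) (p : alg R n X) (E : X -> bool) :
  Pr A p E = expect A p (fun x => (E x)%:R).
Proof.
elim: p => [x|q k IH|i v k IH] //=.
by congr (_ / _); apply: eq_bigr => S _; rewrite IH.
Qed.

Lemma expect_bind (X Y : Type) (p : alg R n X) (f : X -> alg R n Y) F :
  expect A (bind p f) F = expect A p (fun x => expect A (f x) F).
Proof.
by elim: p => [x|q k IH|i v k IH] //=; apply: rademacher_mean_ext => S.
Qed.

Lemma expect_le (X : Type) (p : alg R n X) (F G : X -> R) :
  (forall x, F x <= G x) -> expect A p F <= expect A p G.
Proof.
move=> FG; elim: p => [x|q k IH|i v k IH] //=.
by apply: rademacher_mean_le => S.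
Qed.

Lemma expect_ext (X : Type) (p : alg R n X) (F G : X -> R) :
  (forall x, F x = G x) -> expect A p F = expect A p G.
Proof.
move=> FG; elim: p => [x|q k IH|i v k IH] //=.
by apply: rademacher_mean_ext => S.
Qed.

Lemma expectD (X : Type) (p : alg R n X) (F G : X -> R) :
  expect A p (fun x => F x + G x) = expect A p F + expect A p G.
Proof.
elim: p => [x|q k IH|i v k IH] //=.
by rewrite -rademacher_meanD; apply: rademacher_mean_ext => S.
Qed.

Lemma expectZ (X : Type) (p : alg R n X) (c : R) (F : X -> R) :
  expect A p (fun x => c * F x) = c * expect A p F.
Proof.
elim: p => [x|q k IH|i v k IH] //=.
by rewrite -rademacher_meanZ; apply: rademacher_mean_ext => S.
Qed.

Lemma expect_cst (X : Type) (p : alg R n X) (c : R) :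
  expect A p (fun=> c) = c.
Proof.
elim: p => [x|q k IH|i v k IH] //=.
by rewrite -[RHS](@rademacher_mean_cst R n q); apply: rademacher_mean_ext => S.
Qed.

(** The noise [g] is centered, so the cross term disappears. *)
Lemma expect_affine_sqr (X : Type) (p : alg R n X) (g : X -> R) (u c V : R) :
  expect A p g = 0 -> expect A p (fun x => g x ^+ 2) <= V ->
  expect A p (fun x => (u + c * g x) ^+ 2) <= u ^+ 2 + c ^+ 2 * V.
Proof.
move=> g0 gV; rewrite (@expect_ext _ _ _ (fun x =>
  u ^+ 2 + (2 * u * c * g x + c ^+ 2 * g x ^+ 2))) => [|x]; last by ring.
rewrite !expectD !expectZ expect_cst g0 mulr0 add0r lerD2l.
by rewrite ler_wpM2l // sqr_ge0.
Qed.

Lemma expect_matmul (o : oracle R n) (B : 'M[R]_n) :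
  (forall v F, expect A (o v) F = F (B *m v)) ->
  forall q (V : 'M[R]_(n, q)) F, expect A (matmul o V) F = F (B *m V).
Proof.
move=> oB; elim=> [|q IHq] V F.
  by have -> : B *m V = V by apply/matrixP => i [].
rewrite /= expect_bind oB expect_bind IHq /=; congr F.
by rewrite -mul_mx_row hsubmxK.
Qed.

Lemma expect_hutchpp (o : oracle R n) (B : 'M[R]_n) (orth : orthonormalizer R n)
    (l : nat) (F : R -> R) :
  (forall v F, expect A (o v) F = F (B *m v)) ->
  expect A (hutchpp orth l o) F =
  rademacher_mean (fun S => rademacher_mean (fun G =>
    F (@hutchpp_value R n orth l B S G))).
Proof.
move=> oB; rewrite /hutchpp /=; apply: rademacher_mean_ext => S.
apply: rademacher_mean_ext => G.
do 3 rewrite expect_bind (expect_matmul oB).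
by rewrite /= /hutchpp_value !mulmxA.
Qed.

Lemma expect_orc i v F : expect A (@orc R n i v) F = F (A i *m v).
Proof. by []. Qed.

Lemma expect_orc_diff i j v F :
  expect A (@orc_diff R n i j v) F = F ((A i - A j) *m v).
Proof. by rewrite /= mulmxBl. Qed.

Lemma num_matvec_bind (X Y : Type) (p : alg R n X) (f : X -> alg R n Y) (c : nat) :
  (forall x, num_matvec A (f x) <= c)%N ->
  (num_matvec A (bind p f) <= num_matvec A p + c)%N.
Proof.
move=> fc; elim: p => [x|q k IH|i v k IH] //=; last by rewrite addSn ltnS.
apply/bigmax_leqP => S _; apply: leq_trans (IH _) _; rewrite leq_add2r.
exact: (leq_bigmax S).
Qed.

End Expect.

(** * DeltaShift++ *)

Lemma sample_sizeE (R : realType) (z : R) : 0 < z ->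
  exists k : nat, [/\ sample_size z = (3 * k)%N, (0 < k)%N,
    z <= k%:R & k%:R <= z + 1].
Proof.
move=> z_gt0; exists `|Num.ceil z|%N.
have c_gt0 : 0 < Num.ceil z by rewrite ceil_gt0.
have kE : `|Num.ceil z|%N%:R = (Num.ceil z)%:~R :> R.
  by rewrite natr_absz ger0_norm // ltW.
split=> //; rewrite ?absz_gt0 ?gt_eqF // kE.
  exact: ceil_ge.
by have := ceilB1_lt z; rewrite intrB; lra.
Qed.

Section DeltaShift.
Variables (R : realType) (n : nat) (A : nat -> 'M[R]_n).
Variables (orth : orthonormalizer R n) (l0 l : nat) (gamma : R).
Local Notation run := (deltashiftpp orth l0 l gamma).

Lemma deltashiftppS (m : nat) : run m.+2 =
  let* ts := run m.+1 in
  let* a := hutchpp orth l (orc m.+2) in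
  let* b := hutchpp orth l (orc_diff m.+2 m.+1) in
  Ret (rcons ts (gamma * a + (1 - gamma) * (last 0 ts + b))).
Proof. by []. Qed.

Lemma expect_deltashiftppS (m : nat) F :
  expect A (run m.+2) F = expect A (run m.+1) (fun ts =>
    expect A (hutchpp orth l (orc m.+2)) (fun a =>
    expect A (hutchpp orth l (orc_diff m.+2 m.+1)) (fun b =>
      F (rcons ts (gamma * a + (1 - gamma) * (last 0 ts + b)))))).
Proof.
rewrite deltashiftppS expect_bind; apply: expect_ext => ts.
by rewrite expect_bind; apply: expect_ext => a; rewrite expect_bind.
Qed.

Lemma expect_deltashiftpp1 F :
  expect A (run 1) F = expect A (hutchpp orth l0 (orc 1)) (fun t => F [:: t]).
Proof. exact: expect_bind. Qed.

Lemma expect_deltashiftpp_size (m : nat) (F G : seq R -> R) :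
  (forall ts, size ts = m -> F ts = G ts) ->
  expect A (run m) F = expect A (run m) G.
Proof.
elim: m F G => [|[|m] IHm] F G FG; first exact: FG.
  by rewrite !expect_deltashiftpp1; apply: expect_ext => t; exact: FG.
rewrite !expect_deltashiftppS; apply: IHm => ts ts_m.
do 2 (apply: expect_ext => ?); by rewrite FG // size_rcons ts_m.
Qed.

(** An estimate is never revised once output, so the later steps integrate out. *)
Lemma expect_deltashiftpp_nth (m i : nat) (F : R -> R) : (1 <= i <= m)%N ->
  expect A (run m) (fun ts => F (nth 0 ts i.-1)) =
  expect A (run i) (fun ts => F (last 0 ts)).
Proof.
move=> /andP[i_gt0]; elim: m => [|m IHm]; first by rewrite leqNgt i_gt0.
rewrite leq_eqVlt => /predU1P[->|im].
  by apply: expect_deltashiftpp_size => ts ts_m; rewrite -nth_last ts_m.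
case: m im IHm => [|m] im IHm; first by rewrite ltnS leqNgt i_gt0 in im.
rewrite -IHm // expect_deltashiftppS; apply: expect_deltashiftpp_size => ts ts_m.
rewrite -[RHS](expect_cst A (hutchpp orth l (orc m.+2))); apply: expect_ext => a.
rewrite -[RHS](expect_cst A (hutchpp orth l (orc_diff m.+2 m.+1))).
apply: expect_ext => b; rewrite nth_rcons ts_m.
by have -> : (i.-1 < m.+1)%N by rewrite prednK.
Qed.

(** Each step after the first spends at most [l] products on the current matrix and [2 * l] on the
    difference, whose oracle queries two matrices. *)
Lemma num_matvec_deltashiftpp (m : nat) :
  (num_matvec A (run m.+1) <= l0 + m * (3 * l))%N.
Proof.
elim: m => [|m IHm].
  apply: leq_trans (num_matvec_bind (c := 0%N) _ _) _ => //.
  rewrite !addn0 -[X in (_ <= X)%N]muln1.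
  exact: (hutchppP orth l0 (computes_orc A 1)).2.
rewrite deltashiftppS mulSn [(3 * l + _)%N]addnC addnA.
apply: leq_trans (num_matvec_bind (c := (3 * l)%N) _ _) _; last by rewrite leq_add2r.
move=> ts.
apply: leq_trans (num_matvec_bind (c := (l * 2)%N) _ _) _ => [a|].
  apply: leq_trans (num_matvec_bind (c := 0%N) _ _) _ => //; rewrite addn0.
  exact: (hutchppP orth l (computes_orc_diff A m.+2 m.+1)).2.
have -> : (3 * l = l * 1 + l * 2)%N by rewrite -mulnDr mulnC.
by rewrite leq_add2r; exact: (hutchppP orth l (computes_orc A m.+2)).2.
Qed.

Variables (k0 k m : nat).
Hypothesis orthP : orthonormalizes orth.
Hypotheses (l0E : l0 = (3 * k0)%N) (lE : l = (3 * k)%N).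
Hypotheses (k0_gt0 : (0 < k0)%N) (k_gt0 : (0 < k)%N).
Hypothesis gamma_itv : 0 < gamma < 1.
Hypothesis A_bound : forall i, (1 <= i <= m)%N -> nuclear_norm (A i) <= 1.
Hypothesis diff_bound :
  forall i, (1 <= i < m)%N -> nuclear_norm (A i.+1 - A i) <= gamma.

Lemma hutchpp_moments (o : oracle R n) (B : 'M[R]_n) (N : R) (l' k' : nat) :
  (forall v F, expect A (o v) F = F (B *m v)) ->
  l' = (3 * k')%N -> (0 < k')%N -> 0 < N -> nuclear_norm B <= N ->
  expect A (hutchpp orth l' o) (fun t => t - \tr B) = 0 /\
  expect A (hutchpp orth l' o) (fun t => (t - \tr B) ^+ 2)
    <= 6 * N ^+ 2 / k'%:R ^+ 2.
Proof.
move=> oB l'E k'_gt0 N_gt0 BN.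
have kE : k' = (l' %/ 3)%N by rewrite l'E mulKn.
rewrite !(expect_hutchpp _ _ _ oB) kE; rewrite kE in l'E k'_gt0.
by split; [exact: hutchpp_value_unbiased|exact: hutchpp_value_var].
Qed.

(* The variance obeys [v' <= (1 - gamma) v + 12 gamma^2 / k^2]: damping keeps it
   below [12 gamma / k^2] however long the sequence. *)
Lemma deltashiftpp_var (v : R) (j : nat) :
  6 / k0%:R ^+ 2 <= v -> 12 * gamma / k%:R ^+ 2 <= v -> (j < m)%N ->
  expect A (run j.+1) (fun ts => (last 0 ts - \tr (A j.+1)) ^+ 2) <= v.
Proof.
move=> v0 v1; case/andP: (gamma_itv) => g_gt0 g_lt1.
elim: j => [|j IHj] jm.
  rewrite expect_deltashiftpp1 /=.
  have [_] := hutchpp_moments (expect_orc A 1) l0E k0_gt0 ltr01 (A_bound (i := 1) jm).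
  by move/le_trans; apply; rewrite expr1n mulr1.
have j2m : (1 <= j.+2 <= m)%N by [].
have [a0 aV] := hutchpp_moments (expect_orc A j.+2) lE k_gt0 ltr01 (A_bound j2m).
have [b0 bV] := hutchpp_moments (expect_orc_diff A j.+2 j.+1) lE k_gt0 g_gt0
  (diff_bound (i := j.+1) jm).
set Va := 6 * 1 ^+ 2 / _ in aV; set Vb := 6 * gamma ^+ 2 / _ in bV.
rewrite expect_deltashiftppS.
(* The new error is [1 - gamma] times the old one plus the centered errors of [a] and [b], weighted
   by [gamma] and [1 - gamma]; these are averaged out in turn, [b] first. *)
apply: (@le_trans _ _ (expect A (run j.+1) (fun ts =>
   (1 - gamma) ^+ 2 * (last 0 ts - \tr (A j.+1)) ^+ 2
   + (gamma ^+ 2 * Va + (1 - gamma) ^+ 2 * Vb)))).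
  apply: expect_le => ts; set x := last 0 ts - \tr (A j.+1).
  apply: (@le_trans _ _ (expect A (hutchpp orth l (orc j.+2)) (fun a =>
     ((1 - gamma) * x + gamma * (a - \tr (A j.+2))) ^+ 2 + (1 - gamma) ^+ 2 * Vb))).
    apply: expect_le => a; apply: le_trans (expect_affine_sqr _ _ b0 bV).
    rewrite le_eqVlt; apply/orP; left; apply/eqP/expect_ext => b.
    by rewrite last_rcons /x raddfB /=; ring.
  rewrite expectD expect_cst addrA lerD2r.
  by apply: le_trans (expect_affine_sqr _ _ a0 aV) _; rewrite exprMn.
rewrite expectD expectZ expect_cst.
set x := expect _ _ _; have xv : x <= v by apply: IHj; exact: ltnW.
have x_ge0 : 0 <= x.
  by rewrite -(expect_cst A (run j.+1) 0); apply: expect_le => ts; exact: sqr_ge0.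
pose w : R := k%:R ^- 2.
have w_ge0 : 0 <= w by rewrite invr_ge0 exprn_ge0.
have VaE : Va = 6 * w by rewrite /Va expr1n mulr1.
have VbE : Vb = gamma ^+ 2 * (6 * w) by rewrite /Vb -/w; ring.
have vw : 12 * gamma * w <= v by exact: v1.
have g2 : 0 <= (1 - gamma) ^+ 2 <= 1 - gamma.
  by rewrite sqr_ge0 /= expr2; nra.
have p1 : (1 - gamma) ^+ 2 * x <= (1 - gamma) * v.
  by apply: ler_pM => //; case/andP: g2.
have p2 : (1 - gamma) ^+ 2 * Vb <= Vb.
  rewrite ler_piMl // ?VbE; last by case/andP: g2 => _ /le_trans; apply; lra.
  by rewrite mulr_ge0 ?sqr_ge0 // mulr_ge0.
(* The part [gamma * v] removed by damping pays for the two fresh variances, [6 * gamma^2 * w] at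
   most for each. *)
have p3 : gamma * (12 * gamma * w) <= gamma * v by rewrite ler_wpM2l // ltW.
move: p1 p2; rewrite VaE VbE; lra.
Qed.

(** Chebyshev's inequality: the indicator of the tail event is at most the squared error over
    [eps^2]. *)
Lemma deltashiftpp_tail (eps delta : R) (i : nat) : 0 < eps ->
  6 / k0%:R ^+ 2 <= eps ^+ 2 * delta ->
  12 * gamma / k%:R ^+ 2 <= eps ^+ 2 * delta -> (1 <= i <= m)%N ->
  Pr A (run m) (fun ts => eps <= `|nth 0 ts i.-1 - \tr (A i)|) <= delta.
Proof.
move=> eps_gt0 v0 v1 i_m.
rewrite Pr_expect.
rewrite (expect_deltashiftpp_nth (fun t => (eps <= `|t - \tr (A i)|)%R%:R)) //.
case: i i_m => // i i_m.
apply: (@le_trans _ _ (expect A (run i.+1) (fun ts =>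
   eps ^- 2 * (last 0 ts - \tr (A i.+1)) ^+ 2))).
  apply: expect_le => ts; rewrite mulrC ler_pdivlMr ?exprn_gt0 //.
  have [le_eps|_] := boolP (_ <= `|_|); last by rewrite mul0r sqr_ge0.
  by rewrite mul1r -[leRHS]real_normK ?num_real // lerXn2r ?nnegrE // ltW.
rewrite expectZ mulrC ler_pdivrMr ?exprn_gt0 // mulrC.
exact: deltashiftpp_var.
Qed.

End DeltaShift.

(** * Constants and cost *)

Unset Implicit Arguments.

Theorem theorem2 (R : realType) :
  exists c0 c K : R,
    [/\ 0 < c0, 0 < c & 0 < K] /\
    forall (eps delta alpha : R),
      0 < eps < 1 -> 0 < delta < 1 -> 0 < alpha < 1 ->
      let y := Num.sqrt (1 / delta) / eps in
      let x := Num.sqrt (alpha / delta) / eps in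
      let l0 := sample_size (c0 * y) in
      let l := sample_size (c * x) in
      forall (n m : nat) (A : nat -> 'M[R]_n) (orth : orthonormalizer R n),
        orthonormalizes orth ->
        (forall i, (1 <= i <= m)%N -> nuclear_norm (A i) <= 1) ->
        (forall i, (1 <= i < m)%N -> nuclear_norm (A i.+1 - A i) <= alpha) ->
        (forall i, (1 <= i <= m)%N ->
           Pr A (deltashiftpp orth l0 l alpha m)
             (fun ts => eps <= `|nth 0 ts i.-1 - \tr (A i)|) <= delta) /\
        (num_matvec A (deltashiftpp orth l0 l alpha m))%:R
          <= K * (m%:R * Num.max 1 x + y).
Proof.
(* [4^2 = 16] covers the factor 12 in the variance bounds. For 45: [3 * l = 9 * k] and
   [k <= 4 * x + 1], whence [45 * Num.max 1 x]. *)
exists 4, 4, 45; split=> // eps delta alpha /andP[e_gt0 e_lt1] /andP[d_gt0 d_lt1].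
move=> a_itv; case/andP: (a_itv) => a_gt0 a_lt1 y x l0 l n m A orth orthP A_bound diff_bound.
have sz (z : R) : 0 < z -> 0 < Num.sqrt (z / delta) / eps.
  by move=> z_gt0; rewrite divr_gt0 // sqrtr_gt0 divr_gt0.
have [k0 [l0E k0_gt0 k0_ge k0_le]] := sample_sizeE (mulr_gt0 (ltr0Sn R 3) (sz _ ltr01)).
have [k [lE k_gt0 k_ge k_le]] := sample_sizeE (mulr_gt0 (ltr0Sn R 3) (sz _ a_gt0)).
rewrite -/y -/l0 in l0E k0_ge k0_le; rewrite -/x -/l in lE k_ge k_le.
have var (z : R) (j : nat) : 0 < z -> (0 < j)%N ->
    4 * (Num.sqrt (z / delta) / eps) <= j%:R -> 12 * z / j%:R ^+ 2 <= eps ^+ 2 * delta.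
  move=> z_gt0 j_gt0 zj; have j0 : 0 < j%:R :> R by rewrite ltr0n.
  rewrite ler_pdivrMr ?exprn_gt0 //.
  have : (4 * (Num.sqrt (z / delta) / eps)) ^+ 2 <= j%:R ^+ 2.
    have z_ge0 := ltW (sz _ z_gt0).
    by apply: lerXn2r => //; rewrite nnegrE ?(ltW j0) // mulr_ge0.
  rewrite exprMn expr_div_n sqr_sqrtr; last by rewrite ltW // divr_gt0.
  move=> zj2; apply: (@le_trans _ _ (eps ^+ 2 * delta * (4 ^+ 2 * (z / delta / eps ^+ 2)))).
    have -> : eps ^+ 2 * delta * (4 ^+ 2 * (z / delta / eps ^+ 2)) = 16 * z.
      by field; rewrite !gt_eqF.
    by rewrite ler_pM2r // ler_nat.
  by rewrite ler_wpM2l // mulr_ge0 ?sqr_ge0 // ltW.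
split=> [i i_m|].
  apply: (deltashiftpp_tail orthP l0E lE k0_gt0 k_gt0 a_itv A_bound diff_bound) => //.
    apply: le_trans (var 1 k0 ltr01 k0_gt0 k0_ge); rewrite mulr1.
    by rewrite ler_wpM2r ?ler_nat // invr_ge0 sqr_ge0.
  exact: var.
have x_gt0 : 0 < x by exact: sz.
(* This absorbs the rounding up of [4 * y] to [k0]. *)
have y_ge1 : 1 <= y.
  rewrite /y ler_pdivlMr // !mul1r (le_trans (ltW e_lt1)) //.
  by rewrite -sqrtr1 ler_wsqrtr // invf_ge1 // ltW.
have max_ge0 : 0 <= Num.max 1 x by rewrite le_max ler01.
case: m A_bound diff_bound => [|m] _ _.
  by rewrite /= mul0r add0r mulr_ge0 // (le_trans ler01).
apply: (@le_trans _ _ (l0 + m * (3 * l))%:R).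
  by rewrite ler_nat; exact: num_matvec_deltashiftpp.
have l0_le : l0%:R <= 45 * y by rewrite l0E natrM; lra.
have l_le : (3 * l)%:R <= 45 * Num.max 1 x.
  have x_le : x <= Num.max 1 x by rewrite le_max lexx orbT.
  have one_le : 1 <= Num.max 1 x by rewrite le_max lexx.
  by rewrite lE !natrM; lra.
have ml : m%:R * (3 * l)%:R <= m%:R * (45 * Num.max 1 x) by rewrite ler_wpM2l ?ler0n.
have -> : 45 * (m.+1%:R * Num.max 1 x + y)
    = m%:R * (45 * Num.max 1 x) + 45 * Num.max 1 x + 45 * y by rewrite -natr1; ring.
by rewrite natrD (natrM _ m); lra.
Qed.
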